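(* Let $k$ be a field of characteristic $p>0$, let $G$ be a finite group with $p$ dividing $|G|$, and let $w$ be a finite dimensional $kG$-module with vertex (conjugate to) $Q$. Assume that $G$ and $w$ satisfy the following conditions: (1) if $P$ is a Sylow $p$-subgroup of $G$, then $P$ is isomorphic to $P'\times C_q$ for some $P'$, where $C_q$ is a cyclic group of order $q$ and $q>1$ is a power of $p$; (2) in such a decomposition, $Q\leq_G P'$; (3) there is a $kP'$-module $M$ such that neither $M$ nor $M\otimes_k \mathrm{Res}^G_{P'}(w)$ is pure projective (in particular $kQ$, and thus $kP'$, cannot have finite representation type). Then $\mathrm{stmod}_w(kG)$ does not generate $\mathrm{StMod}_w(kG)$ as a triangulated category.
   Context: $\mathrm{Mod}(kG)$ is the category of all $kG$-modules and $\mathrm{mod}(kG)$ is the full subcategory of finite dimensional ones. Tensor products of modules are over $k$ with the diagonal group action. Modules are not assumed finite dimensional unless stated. For a finite dimensional $kG$-module $w$, $\mathcal{P}(w)$ denotes the smallest additive (full) subcategory of $\mathrm{Mod}(kG)$ that contains $w$ and is closed under tensoring with an arbitrary $kG$-module and under arbitrary direct sums and direct summands. Objects of $\mathcal{P}(w)$ are called $w$-projective. The class of short exact sequences in $\mathrm{Mod}(kG)$ that split when tensored with $w$ is an exact structure whose projective objects and injective objects are both exactly $\mathcal{P}(w)$, with enough of both. The resulting triangulated quotients are $\mathrm{StMod}_w(kG):=\mathrm{Mod}(kG)/\mathcal{P}(w)$ and $\mathrm{stmod}_w(kG):=\mathrm{mod}(kG)/(\mathcal{P}(w)\cap \mathrm{mod}(kG))$: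 the objects are the same as those of the original category, and morphisms are module homomorphisms modulo those factoring through a $w$-projective module. $\mathrm{stmod}_w(kG)$ is regarded as a full subcategory of $\mathrm{StMod}_w(kG)$. If $\mathcal{S}\subset\mathcal{T}$ are triangulated categories, $\mathcal{S}$ generates $\mathcal{T}$ if, for every object $X$ of $\mathcal{T}$, $\mathrm{Hom}_{\mathcal{T}}(S,X)=0$ for all $S\in\mathcal{S}$ implies $X\cong 0$. For a subgroup $K\le G$, a $kG$-module is $K$-projective (projective with respect to $K$) if it is a direct summand of $\mathrm{Ind}_K^G(V)$ for some $kK$-module $V$. A vertex of $w$ is a subgroup $Q$ of $G$ minimal with the property that $w$ is $Q$-projective (unique up to $G$-conjugacy when $w$ is indecomposable). $Q\leq_G P'$ means that some $G$-conjugate of $Q$ is contained in $P'$; here $P'$ is identified with a subgroup of $P\le G$ via the decomposition $P\cong P'\times C_q$. A module is pure projective if it is a direct summand of a direct sum of finite dimensional modules. A group algebra has finite representation type if it has only finitely many isomorphism classes of finite dimensional indecomposable modules. *)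

(* Defs.v *)
(* Modules have arbitrary dimension, hence the classical axioms of boolp. *)
From HB Require Import structures.
From mathcomp Require Import all_boot all_order all_fingroup all_algebra.
From mathcomp Require Import all_solvable.
From mathcomp Require Import boolp classical_sets functions cardinality.
From mathcomp Require Import generic_quotient ring_quotient.
From mathcomp.multinomials Require Import freeg.

Set Implicit Arguments.
Unset Strict Implicit.
Unset Printing Implicit Defensive.

Import GRing.Theory.
Local Open Scope ring_scope.
Local Open Scope quotient_scope.

Section Submodules.
Variables (k : fieldType) (V : lmodType k) (S : V -> Prop).

Inductive in_span : V -> Prop :=
| in_span0 : in_span 0
| in_spanP a u v : S u -> in_span v -> in_span (a *: u + v).

Definition lspan : {pred V} := fun v => `[< in_span v >].

Lemma lspan_submod : submod_closed lspan.
Proof.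
split; first by apply/asboolP; constructor.
move=> a u v /asboolP su /asboolP sv; apply/asboolP.
elim: su => [|b x y Sx _ IH]; first by rewrite scaler0 add0r.
by rewrite scalerDr scalerA -addrA; apply: in_spanP.
Qed.
HB.instance Definition _ := GRing.isSubmodClosed.Build k V lspan lspan_submod.

Lemma mem_lspan v : S v -> v \in lspan.
Proof.
move=> Sv; apply/asboolP; rewrite -[v]addr0 -[v]scale1r.
by apply: in_spanP => //; apply: in_span0.
Qed.

(* The quotient of V by the subspace spanned by S. *)
Definition lquot : Type := Quotient.quot lspan.
HB.instance Definition _ := GRing.Zmodule.on lquot.
HB.instance Definition _ : EqQuotient V (Quotient.equiv lspan) lquot :=
  EqQuotient.on lquot.

Lemma lquotP (P : lquot -> Prop) : (forall u, P (\pi_lquot u)) -> forall x, P x.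
Proof. by move=> PV x; rewrite -[x]reprK. Qed.

Lemma lquot_eq (u v : V) : (\pi_lquot u = \pi_lquot v) <-> (u - v \in lspan).
Proof.
rewrite (Quotient.idealrBE lspan).
by split=> [e|/eqP //]; apply/eqP.
Qed.

Lemma lquot_piD (u v : V) : \pi_lquot (u + v) = \pi_lquot u + \pi_lquot v.
Proof. exact: (raddfD (\pi_(Quotient.quot lspan))). Qed.

Definition lquot_scale (a : k) (x : lquot) : lquot := \pi_lquot (a *: repr x).

Lemma lquot_piZ a (u : V) : lquot_scale a (\pi_lquot u) = \pi_lquot (a *: u).
Proof.
apply/lquot_eq; rewrite -scalerBr rpredZ //.
by apply/lquot_eq; rewrite reprK.
Qed.

Fact lquot_scaleA a b x :
  lquot_scale a (lquot_scale b x) = lquot_scale (a * b) x.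
Proof. by elim/lquotP: x => u; rewrite !lquot_piZ scalerA. Qed.
Fact lquot_scale1 : left_id 1 lquot_scale.
Proof. by move=> x; elim/lquotP: x => u; rewrite lquot_piZ scale1r. Qed.
Fact lquot_scaleDr : right_distributive lquot_scale +%R.
Proof.
move=> a x y; elim/lquotP: x => u; elim/lquotP: y => v.
by rewrite -lquot_piD !lquot_piZ scalerDr lquot_piD.
Qed.
Fact lquot_scaleDl x : {morph lquot_scale^~ x : a b / a + b}.
Proof. by elim/lquotP: x => u a b; rewrite !lquot_piZ scalerDl lquot_piD. Qed.
HB.instance Definition _ := GRing.Zmodule_isLmodule.Build k lquot
  lquot_scaleA lquot_scale1 lquot_scaleDr lquot_scaleDl.

Lemma lquot_pi_linear : linear (\pi_lquot : V -> lquot).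
Proof. by move=> a u v; rewrite lquot_piD -lquot_piZ. Qed.

Section Lift.
Variables (M : lmodType k) (f : V -> M).
Hypotheses (f_lin : linear f) (fS : forall u, S u -> f u = 0).

Lemma linear_fun0 : f 0 = 0.
Proof. by have := f_lin (-1) 0 0; rewrite scaler0 addr0 scaleN1r addNr. Qed.

Lemma lquot_lift (u : V) : f (repr (\pi_lquot u)) = f u.
Proof.
have key d : in_span d -> forall v, f (d + v) = f v.
  elim=> [|a x y Sx _ IH] v; first by rewrite add0r.
  by rewrite -addrA f_lin (fS Sx) scaler0 add0r IH.
rewrite -[repr _](subrK u); apply/key/asboolP/lquot_eq.
by rewrite reprK.
Qed.

Lemma lquot_lift_linear : linear (fun x : lquot => f (repr x)).
Proof.
move=> a x y; elim/lquotP: x => u; elim/lquotP: y => v.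
by rewrite -lquot_pi_linear !lquot_lift f_lin.
Qed.

End Lift.

End Submodules.

Section FreeLift.
Variables (k : fieldType) (A : choiceType).

Definition fbasis (x : A) : {freeg A / k} := << x >>.

Lemma fbasisZ a x : a *: fbasis x = << a *g x >>.
Proof.
by apply/eqP/freeg_eqP => y; rewrite coeffZ !coeffU mul1r.
Qed.

Lemma free_sumE (u : {freeg A / k}) :
  u = \sum_(x <- dom u) coeff x u *: fbasis x.
Proof. by rewrite -[LHS]freeg_sumE; apply: eq_bigr => x _; rewrite fbasisZ. Qed.

Variables (M : lmodType k) (f : A -> M).

Lemma linear_free_eq (g h : {freeg A / k} -> M) : linear g -> linear h ->
  (forall x, g (fbasis x) = h (fbasis x)) -> g =1 h.
Proof.
move=> g_lin h_lin gh u; rewrite [u]free_sumE.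
elim: (dom u) => [|x s IH]; first by rewrite !big_nil !linear_fun0.
by rewrite !big_cons g_lin h_lin gh IH.
Qed.

Lemma fglift_basis x : fglift f (fbasis x) = f x.
Proof. by rewrite liftU scale1r. Qed.

Lemma fglift_linear : linear (fglift f).
Proof.
pose g := GRing.isZmodMorphism.Build _ _ (fglift f) (lift_is_additive f).
pose fa : {additive {freeg A / k} -> M} := HB.pack (fglift f) g.
have fE u : fglift f u = \sum_(x <- dom u) coeff x u *: f x.
  rewrite {1}[u]free_sumE -[LHS]/(fa _) raddf_sum; apply: eq_bigr => x _ /=.
  by rewrite fbasisZ liftU.
move=> a u v; rewrite -[LHS]/(fa _) raddfD /=; congr (_ + _).
rewrite {1}[u]free_sumE scaler_sumr -[LHS]/(fa _) raddf_sum /= fE scaler_sumr.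
by apply: eq_bigr => x _; rewrite scalerA fbasisZ liftU scalerA.
Qed.

End FreeLift.

Section Modules.
Variables (k : fieldType) (gT : finGroupType).

(* Only the values of the action at the elements of G are meaningful. *)
Record kGmod (G : {group gT}) := KGmod {
  kG_sort :> lmodType k;
  kG_act : gT -> kG_sort -> kG_sort;
  kG_act_linear : forall g, g \in G -> linear (kG_act g);
  kG_act1 : forall v, kG_act 1%g v = v;
  kG_actM : forall g h, g \in G -> h \in G ->
    forall v, kG_act (g * h)%g v = kG_act g (kG_act h v) }.

Definition kG_findim G (X : kGmod G) := exists n, inhabited (Vector.axiom n X).

Definition kG_zero G : kGmod G.
Proof. by exists ('rV[k]_0 : lmodType k) (fun _ v => v). Defined.

Section Hom.
Variables (G : {group gT}) (X Y : kGmod G).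

Definition is_kG_hom (f : X -> Y) :=
  linear f /\ forall g, g \in G -> forall x, f (kG_act g x) = kG_act g (f x).

Definition kG_hom_pred : {pred X -> Y} := fun f => `[< is_kG_hom f >].

Lemma kG_hom_submod : submod_closed kG_hom_pred.
Proof.
split.
  apply/asboolP; split; first by move=> a u v; rewrite /= scaler0 addr0.
  by move=> g gG x; rewrite (linear_fun0 (kG_act_linear gG)).
move=> a f h /asboolP[fl fG] /asboolP[hl hG]; apply/asboolP; split.
  move=> b u v; rewrite !fctE /= fl hl !scalerDr !scalerA [b * a]mulrC.
  by rewrite addrACA.
by move=> g gG x; rewrite !fctE /= fG // hG // kG_act_linear.
Qed.
HB.instance Definition _ :=
  GRing.isSubmodClosed.Build k (X -> Y) kG_hom_pred kG_hom_submod.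

Record kG_hom := KGHom { kG_hom_fun :> X -> Y; _ : kG_hom_fun \in kG_hom_pred }.
HB.instance Definition _ := [isSub for kG_hom_fun].
HB.instance Definition _ := [Choice of kG_hom by <:].
HB.instance Definition _ := [SubChoice_isSubLmodule of kG_hom by <:].

Lemma kG_homP (f : kG_hom) : is_kG_hom f.
Proof. by case: f => f fP; apply/asboolP. Qed.

Definition mk_kG_hom (f : X -> Y) (fP : is_kG_hom f) : kG_hom :=
  KGHom (introT (asboolP (is_kG_hom f)) fP).

End Hom.

Lemma kG_comp_subproof G (X Y Z : kGmod G) (f : kG_hom Y Z) (h : kG_hom X Y) :
  is_kG_hom (f \o h).
Proof.
case: (kG_homP f) (kG_homP h) => fl fG [hl hG]; split.
  by move=> a u v; rewrite /= hl fl.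
by move=> g gG x; rewrite /= hG // fG.
Qed.
Definition kG_comp G (X Y Z : kGmod G) (f : kG_hom Y Z) (h : kG_hom X Y) :
  kG_hom X Z := mk_kG_hom (kG_comp_subproof f h).

Lemma kG_id_subproof G (X : kGmod G) : is_kG_hom (id : X -> X).
Proof. by []. Qed.
Definition kG_id G (X : kGmod G) : kG_hom X X := mk_kG_hom (kG_id_subproof X).

Definition kG_iso G (X Y : kGmod G) := exists f : kG_hom X Y, bijective f.

Section DirectSum.
Variables (G : {group gT}) (I : Type) (X : I -> kGmod G).

Definition dprod : Type := forall i, X i.
HB.instance Definition _ := Choice.copy dprod (forall i, X i).

Definition dprod_op (f : forall i, X i -> X i -> X i) (x y : dprod) : dprod :=
  fun i => f i (x i) (y i).
Fact dprod_addA : associative (dprod_op (fun=> +%R)).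
Proof. by move=> x y z; apply: functional_extensionality_dep => i; apply: addrA. Qed.
Fact dprod_addC : commutative (dprod_op (fun=> +%R)).
Proof. by move=> x y; apply: functional_extensionality_dep => i; apply: addrC. Qed.
Fact dprod_add0 : left_id ((fun=> 0) : dprod) (dprod_op (fun=> +%R)).
Proof. by move=> x; apply: functional_extensionality_dep => i; apply: add0r. Qed.
Fact dprod_addN : left_inverse ((fun=> 0) : dprod)
  (fun x : dprod => (fun i => - x i) : dprod) (dprod_op (fun=> +%R)).
Proof. by move=> x; apply: functional_extensionality_dep => i; apply: addNr. Qed.
HB.instance Definition _ := GRing.isZmodule.Build dprod
  dprod_addA dprod_addC dprod_add0 dprod_addN.

Definition dprod_scale (a : k) (x : dprod) : dprod := fun i => a *: x i.
Fact dprod_scaleA a b x :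
  dprod_scale a (dprod_scale b x) = dprod_scale (a * b) x.
Proof. by apply: functional_extensionality_dep => i; apply: scalerA. Qed.
Fact dprod_scale1 : left_id 1 dprod_scale.
Proof. by move=> x; apply: functional_extensionality_dep => i; apply: scale1r. Qed.
Fact dprod_scaleDr : right_distributive dprod_scale +%R.
Proof.
by move=> a x y; apply: functional_extensionality_dep => i; apply: scalerDr.
Qed.
Fact dprod_scaleDl x : {morph dprod_scale^~ x : a b / a + b}.
Proof.
by move=> a b; apply: functional_extensionality_dep => i; apply: scalerDl.
Qed.
HB.instance Definition _ := GRing.Zmodule_isLmodule.Build k dprod
  dprod_scaleA dprod_scale1 dprod_scaleDr dprod_scaleDl.

Definition fin_supp : {pred dprod} :=
  fun x => `[< finite_set [set i | x i != 0] >].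

Lemma fin_supp_submod : submod_closed fin_supp.
Proof.
split.
  apply/asboolP; rewrite (_ : [set _ | _] = set0)%classic ?finite_set0 //.
  by apply/seteqP; split=> i //=; rewrite eqxx.
move=> a x y /asboolP fx /asboolP fy; apply/asboolP.
apply: (@sub_finite_set _ _ ([set i | x i != 0] `|` [set i | y i != 0])%classic).
  move=> i /= nz; have [x0|] := eqVneq (x i) 0; [right=> /= | by left].
  by move: nz; rewrite -[(a *: x + y) i]/(a *: x i + y i) x0 scaler0 add0r.
by rewrite finite_setU.
Qed.
HB.instance Definition _ :=
  GRing.isSubmodClosed.Build k dprod fin_supp fin_supp_submod.

Record dsum_sort := DSum { dsum_val : dprod; dsum_valP : dsum_val \in fin_supp }.
HB.instance Definition _ := [isSub for dsum_val].
Definition dsum_fun (x : dsum_sort) : forall i, X i := dsum_val x.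
Coercion dsum_fun : dsum_sort >-> Funclass.
HB.instance Definition _ := [Choice of dsum_sort by <:].
HB.instance Definition _ := [SubChoice_isSubLmodule of dsum_sort by <:].

Lemma dsum_act_subproof g (x : dsum_sort) : g \in G ->
  ((fun i => kG_act g (x i)) : dprod) \in fin_supp.
Proof.
move=> gG; have /asboolP fx := dsum_valP x; apply/asboolP.
apply: sub_finite_set fx => i /=; apply: contra_neq; rewrite /dsum_fun => ->.
exact/linear_fun0/kG_act_linear.
Qed.

Definition dsum_act g (x : dsum_sort) : dsum_sort :=
  if @idP (g \in G) is ReflectT gG then DSum (dsum_act_subproof x gG) else x.

Lemma dsum_actE g x i : g \in G -> dsum_act g x i = kG_act g (x i).
Proof. by move=> gG; rewrite /dsum_act; case: {-}_ / idP. Qed.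

Lemma dsum_eq (x y : dsum_sort) : (forall i, x i = y i) -> x = y.
Proof. by move=> xy; apply/val_inj/functional_extensionality_dep. Qed.

Definition kG_dsum : kGmod G.
Proof.
exists (dsum_sort : lmodType k) dsum_act.
- move=> g gG a x y; apply: dsum_eq => i.
  by rewrite dsum_actE // [LHS]kG_act_linear // -!dsum_actE.
- by move=> x; apply: dsum_eq => i; rewrite dsum_actE // kG_act1.
- by move=> g h gG hG x; apply: dsum_eq => i; rewrite !dsum_actE ?groupM ?kG_actM.
Defined.

End DirectSum.

Section BinarySum.
Variables (G : {group gT}) (X Y : kGmod G).

Definition kG_sum2 : kGmod G.
Proof.
exists ((X * Y)%type : lmodType k) (fun g z => (kG_act g z.1, kG_act g z.2)).
- by move=> g gG a [x y] [x' y']; congr pair; apply: kG_act_linear.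
- by case=> x y /=; rewrite !kG_act1.
- by move=> g h gG hG [x y] /=; rewrite !kG_actM.
Defined.

End BinarySum.

Definition direct_summand G (X Y : kGmod G) :=
  exists Z : kGmod G, kG_iso Y (kG_sum2 X Z).

Section Tensor.
Variables (G : {group gT}) (X Y : kGmod G).

Inductive tensor_rel : {freeg (X * Y)%type / k} -> Prop :=
| tensor_rel_l a x x' y : tensor_rel
    (fbasis k (a *: x + x', y) - (a *: fbasis k (x, y) + fbasis k (x', y)))
| tensor_rel_r a x y y' : tensor_rel
    (fbasis k (x, a *: y + y') - (a *: fbasis k (x, y) + fbasis k (x, y'))).

Definition tensor_sort : lmodType k := lquot tensor_rel.

Definition tens (x : X) (y : Y) : tensor_sort :=
  \pi_(lquot tensor_rel) (fbasis k (x, y)).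

Lemma tens_linear_l y : linear (tens^~ y).
Proof.
move=> a x x'; rewrite -lquot_pi_linear; apply/lquot_eq.
exact/mem_lspan/tensor_rel_l.
Qed.

Lemma tens_linear_r x : linear (tens x).
Proof.
move=> a y y'; rewrite -lquot_pi_linear; apply/lquot_eq.
exact/mem_lspan/tensor_rel_r.
Qed.

Section Univ.
Variables (M : lmodType k) (b : X -> Y -> M).

Definition tensor_lift (t : tensor_sort) : M :=
  fglift (fun p : X * Y => b p.1 p.2) (repr (t : lquot tensor_rel)).

Hypotheses (bl : forall y, linear (b^~ y)) (br : forall x, linear (b x)).

Let tensor_rel0 u : tensor_rel u -> fglift (fun p : X * Y => b p.1 p.2) u = 0.
Proof.
pose f := fglift (fun p : X * Y => b p.1 p.2).
have fB u1 u2 : f (u1 - u2) = f u1 - f u2 by apply: lift_is_additive.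
by case=> *; rewrite -/f fB /f fglift_linear !fglift_basis /= (bl, br) subrr.
Qed.

Lemma tensor_lift_linear : linear tensor_lift.
Proof. by apply: lquot_lift_linear; [apply: fglift_linear | apply: tensor_rel0]. Qed.

Lemma tensor_liftE x y : tensor_lift (tens x y) = b x y.
Proof.
by rewrite /tensor_lift (lquot_lift (fglift_linear _) tensor_rel0) fglift_basis.
Qed.

End Univ.

Lemma tensor_eq (M : lmodType k) (f h : tensor_sort -> M) :
  linear f -> linear h -> (forall x y, f (tens x y) = h (tens x y)) -> f =1 h.
Proof.
move=> fl hl fh; elim/lquotP => u.
apply: (linear_free_eq (g := f \o \pi) (h := h \o \pi)) => [a v w|a v w|[x y]] /=.
- by rewrite lquot_pi_linear fl.
- by rewrite lquot_pi_linear hl.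
exact: fh.
Qed.

Definition tensor_act (g : gT) : tensor_sort -> tensor_sort :=
  tensor_lift (fun x y => tens (kG_act g x) (kG_act g y)).

Lemma tensor_act_linear g : g \in G -> linear (tensor_act g).
Proof.
move=> gG; apply: tensor_lift_linear => [y|x] a u v.
  by rewrite kG_act_linear // tens_linear_l.
by rewrite kG_act_linear // tens_linear_r.
Qed.

Lemma tensor_actE g x y : g \in G ->
  tensor_act g (tens x y) = tens (kG_act g x) (kG_act g y).
Proof.
move=> gG; apply: tensor_liftE => [{}y|{}x] a u v.
  by rewrite kG_act_linear // tens_linear_l.
by rewrite kG_act_linear // tens_linear_r.
Qed.

(* X (x)_k Y with the diagonal action of G. *)
Definition kG_tensor : kGmod G.
Proof.
exists tensor_sort tensor_act => [g gG||g h gG hG].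
- exact: tensor_act_linear.
- apply: tensor_eq => [|//|x y]; first exact: tensor_act_linear.
  by rewrite tensor_actE // !kG_act1.
apply: tensor_eq => [|a u v|x y]; first by apply/tensor_act_linear/groupM.
  by rewrite !tensor_act_linear.
by rewrite !tensor_actE ?groupM // !kG_actM.
Defined.

End Tensor.

Section Restriction.
Variables (K G : {group gT}) (sKG : K \subset G) (X : kGmod G).

Definition kG_res : kGmod K.
Proof.
exists (X : lmodType k) (@kG_act G X) => [g gK||g h gK hK].
- by apply: kG_act_linear; apply: (fintype.subsetP sKG).
- exact: kG_act1.
by apply: kG_actM; apply: (fintype.subsetP sKG).
Defined.

End Restriction.

Section Induction.
Variables (K G : {group gT}) (V : kGmod K).

Inductive ind_rel : {freeg (subg_of G * V)%type / k} -> Prop :=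
| ind_rel_linear x a u v : ind_rel
    (fbasis k (x, a *: u + v) - (a *: fbasis k (x, u) + fbasis k (x, v)))
| ind_rel_balanced x h v : h \in K -> ind_rel
    (fbasis k ((x * subg G h)%g, v) - fbasis k (x, kG_act h v)).

Definition ind_sort : lmodType k := lquot ind_rel.

Definition ind_tens (x : subg_of G) (v : V) : ind_sort :=
  \pi_(lquot ind_rel) (fbasis k (x, v)).

Lemma ind_tens_linear x : linear (ind_tens x).
Proof.
move=> a u v; rewrite -lquot_pi_linear; apply/lquot_eq.
exact/mem_lspan/ind_rel_linear.
Qed.

Lemma ind_tens_balanced x h v : h \in K ->
  ind_tens (x * subg G h)%g v = ind_tens x (kG_act h v).
Proof. by move=> hK; apply/lquot_eq/mem_lspan/ind_rel_balanced. Qed.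

Section Univ.
Variables (M : lmodType k) (b : subg_of G -> V -> M).

Definition ind_lift (t : ind_sort) : M :=
  fglift (fun p : subg_of G * V => b p.1 p.2) (repr (t : lquot ind_rel)).

Hypotheses (b_lin : forall x, linear (b x))
  (b_bal : forall x h v, h \in K -> b (x * subg G h)%g v = b x (kG_act h v)).

Let ind_rel0 u : ind_rel u -> fglift (fun p : subg_of G * V => b p.1 p.2) u = 0.
Proof.
pose f := fglift (fun p : subg_of G * V => b p.1 p.2).
have fB u1 u2 : f (u1 - u2) = f u1 - f u2 by apply: lift_is_additive.
case=> [x a v w|x h v hK]; rewrite -/f fB /f ?fglift_linear !fglift_basis /=.
  by rewrite b_lin subrr.
by rewrite b_bal // subrr.
Qed.

Lemma ind_lift_linear : linear ind_lift.
Proof. by apply: lquot_lift_linear; [apply: fglift_linear | apply: ind_rel0]. Qed.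

Lemma ind_liftE x v : ind_lift (ind_tens x v) = b x v.
Proof.
by rewrite /ind_lift (lquot_lift (fglift_linear _) ind_rel0) fglift_basis.
Qed.

End Univ.

Lemma ind_eq (M : lmodType k) (f h : ind_sort -> M) : linear f -> linear h ->
  (forall x v, f (ind_tens x v) = h (ind_tens x v)) -> f =1 h.
Proof.
move=> fl hl fh; elim/lquotP => u.
apply: (linear_free_eq (g := f \o \pi) (h := h \o \pi)) => [a v w|a v w|[x y]] /=.
- by rewrite lquot_pi_linear fl.
- by rewrite lquot_pi_linear hl.
exact: fh.
Qed.

Definition ind_act (g : gT) : ind_sort -> ind_sort :=
  ind_lift (fun x v => ind_tens (subg G g * x)%g v).

Lemma ind_act_linear g : linear (ind_act g).
Proof.
apply: ind_lift_linear => [x|x h v hK]; first exact: ind_tens_linear.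
by rewrite mulgA ind_tens_balanced.
Qed.

Lemma ind_actE g x v : ind_act g (ind_tens x v) = ind_tens (subg G g * x)%g v.
Proof.
apply: ind_liftE => [{}x|{}x h {}v hK]; first exact: ind_tens_linear.
by rewrite mulgA ind_tens_balanced.
Qed.

(* kG (x)_kK V, for K a subgroup of G. *)
Definition kG_ind : kGmod G.
Proof.
exists ind_sort ind_act => [g gG||g h gG hG].
- exact: ind_act_linear.
- apply: ind_eq => [|//|x v]; first exact: ind_act_linear.
  by rewrite ind_actE (_ : subg G 1 = 1%g) ?mul1g // morph1.
apply: ind_eq => [|a u v|x v]; first exact: ind_act_linear.
  by rewrite !ind_act_linear.
by rewrite !ind_actE mulgA subgM.
Defined.

End Induction.

Definition rel_projective (G K : {group gT}) (X : kGmod G) :=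
  exists V : kGmod K, direct_summand X (kG_ind G V).

Definition is_vertex (G Q : {group gT}) (X : kGmod G) :=
  [/\ Q \subset G, rel_projective Q X &
      forall R : {group gT}, R \proper Q -> ~ rel_projective R X].

Definition pure_projective (G : {group gT}) (X : kGmod G) :=
  exists (I : Type) (F : I -> kGmod G),
    (forall i, kG_findim (F i)) /\ direct_summand X (kG_dsum F).

Section StableCategory.
Variables (G : {group gT}) (w : kGmod G).

(* The class P(w) of w-projective modules.  It is automatically closed under
   isomorphism and finite direct sums. *)
Inductive w_projective : kGmod G -> Prop :=
| w_proj_self : w_projective w
| w_proj_tensor X Y : w_projective X -> w_projective (kG_tensor X Y)
| w_proj_dsum (I : Type) (X : I -> kGmod G) :
    (forall i, w_projective (X i)) -> w_projective (kG_dsum X)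
| w_proj_summand X Y : direct_summand X Y -> w_projective Y -> w_projective X.

Definition w_factors (X Y : kGmod G) (f : kG_hom X Y) :=
  exists (P : kGmod G) (a : kG_hom X P) (b : kG_hom P Y),
    w_projective P /\ f = kG_comp b a.

Lemma w_factors0 X Y : w_factors (0 : kG_hom X Y).
Proof.
exists w, 0, 0; split; first exact: w_proj_self.
by apply/val_inj/funext.
Qed.

Lemma w_factorsP X Y (c : k) (f h : kG_hom X Y) :
  w_factors f -> w_factors h -> w_factors (c *: f + h).
Proof.
move=> [P [a [b [wP ->]]]] [Q [a' [b' [wQ ->]]]].
pose F (t : bool) := if t then P else Q.
pose i0 (x : X) : dprod F :=
  fun t => if t as t' return F t' then c *: a x else a' x.
have i0P x : i0 x \in @fin_supp G bool F by apply/asboolP.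
have [[al aG] [a'l a'G]] := (kG_homP a, kG_homP a').
have [[bl bG] [b'l b'G]] := (kG_homP b, kG_homP b').
have iP : is_kG_hom ((fun x => DSum (i0P x)) : X -> kG_dsum F).
  split=> [d u v|g gG x]; apply: dsum_eq => -[] /=.
  - rewrite -[LHS]/(c *: a (d *: u + v)) -[RHS]/(d *: (c *: a u) + c *: a v).
    by rewrite al scalerDr !scalerA mulrC.
  - exact: a'l.
  - rewrite dsum_actE //; change (c *: a (kG_act g x) = kG_act g (c *: a x)).
    have := kG_act_linear gG c (a x) 0.
    by rewrite (linear_fun0 (kG_act_linear gG)) !addr0 aG.
  - by rewrite dsum_actE //; apply: a'G.
have pP : is_kG_hom ((fun z : dsum_sort F => b (z true) + b' (z false))
    : kG_dsum F -> Y).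
  split=> [d u v|g gG z] /=.
    change (b (d *: u true + v true) + b' (d *: u false + v false) =
      d *: (b (u true) + b' (u false)) + (b (v true) + b' (v false))).
    by rewrite bl b'l scalerDr addrACA.
  have := kG_act_linear gG 1 (b (z true)) (b' (z false)); rewrite !scale1r => ->.
  by rewrite !dsum_actE // -bG // -b'G.
exists (kG_dsum F), (mk_kG_hom iP), (mk_kG_hom pP); split.
  by apply: w_proj_dsum => -[].
apply/val_inj/funext => x /=.
rewrite -[LHS]/(c *: b (a x) + b' (a' x)) -[RHS]/(b (c *: a x) + b' (a' x)).
by have := bl c (a x) 0; rewrite (linear_fun0 bl) !addr0 => ->.
Qed.

Lemma w_factors_span X Y (f : kG_hom X Y) :
  f \in lspan (@w_factors X Y) <-> w_factors f.
Proof.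
split=> [/asboolP|]; last exact: mem_lspan.
by elim=> [|a u v fu _ fv]; [apply: w_factors0 | apply: w_factorsP].
Qed.

(* Morphisms of StMod_w(kG).  By w_factors_span below, the subspace spanned by
   the maps factoring through a w-projective is the set of these maps. *)
Definition st_hom (X Y : kGmod G) : lmodType k := lquot (@w_factors X Y).

Definition st_class X Y (f : kG_hom X Y) : st_hom X Y :=
  \pi_(lquot (@w_factors X Y)) f.

Definition st_repr X Y (f : st_hom X Y) : kG_hom X Y :=
  repr (f : lquot (@w_factors X Y)).

Definition st_comp X Y Z (f : st_hom Y Z) (h : st_hom X Y) : st_hom X Z :=
  st_class (kG_comp (st_repr f) (st_repr h)).

Lemma st_class_eq X Y (f h : kG_hom X Y) :
  st_class f = st_class h <-> w_factors (f - h).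
Proof. by rewrite -w_factors_span; apply: lquot_eq. Qed.

Lemma st_comp_class X Y Z (f : kG_hom Y Z) (h : kG_hom X Y) :
  st_comp (st_class f) (st_class h) = st_class (kG_comp f h).
Proof.
have repr_factors X1 X2 (u : kG_hom X1 X2) : w_factors (st_repr (st_class u) - u).
  by apply/st_class_eq; rewrite /st_class /st_repr reprK.
have [[P [a [b [wP fE]]]] [Q [a' [b' [wQ hE]]]]] :=
  (repr_factors _ _ f, repr_factors _ _ h).
set f' := st_repr _ in fE; set h' := st_repr _ in hE.
have [[fl fG] [f'l f'G]] := (kG_homP f, kG_homP f').
apply/st_class_eq; rewrite -/f' -/h'.
rewrite (_ : _ - _ = 1 *: kG_comp (f' - f) h' + kG_comp f (h' - h)).
  apply: w_factorsP; rewrite (fE, hE).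
    by exists P, (kG_comp a h'), b; split=> //; apply/val_inj.
  by exists Q, a', (kG_comp f b'); split=> //; apply/val_inj.
apply/val_inj/funext => x /=.
rewrite -[LHS]/(f' (h' x) - f (h x)).
rewrite -[RHS]/(1 *: (f' (h' x) - f (h' x)) + f (h' x - h x)).
have := fl (-1) (h x) (h' x); rewrite !scaleN1r [- _ + h' x]addrC => ->.
by rewrite scale1r addrA [_ + f (h' x)]addrAC subrK.
Qed.

Definition st_id X : st_hom X X := st_class (kG_id X).

Definition st_iso X Y := exists (f : st_hom X Y) (h : st_hom Y X),
  st_comp h f = st_id X /\ st_comp f h = st_id Y.

(* The objects of StMod_w(kG) are all kG-modules, so a full subcategory is a
   class of kG-modules. *)
Definition stmod : kGmod G -> Prop := @kG_findim G.

Definition generates_StMod (S : kGmod G -> Prop) :=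
  forall X, (forall Y, S Y -> forall f : st_hom Y X, f = 0) ->
    st_iso X (kG_zero G).

End StableCategory.
End Modules.

(* Main.v *)
Require Import Defs.
From mathcomp Require Import boolp classical_sets functions cardinality.
From mathcomp Require Import all_boot all_order all_fingroup all_algebra.
From mathcomp Require Import all_solvable.
From HB Require Import structures.

(** A module X over G shows that the finite dimensional modules do not generate
    as soon as every map from a finite dimensional module to X factors through
    a w-projective module, while X is not w-projective. Such an X is induced
    from a subgroup H = T x Z with Z of order p.

    Let M be a module over T, let cover M be the direct sum of its finitely
    generated submodules, and let phi : F -> N be the natural map from
    w (x) cover M to w (x) M. Maps from finite dimensional modules to N lift
    through phi (cover_lift). The module total over H consists of the pairs
    (b, a) of functions from Z to F and to N such that phi (b c) is the sum of
    all values of a, for each c in Z; here Z acts by translation. It behaves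
    like the total object of the exact sequence ker phi -> F -> N, and this
    sequence stays exact under maps from finite dimensional modules: a map from
    such a module to total is a sum of traces from T of maps through F and
    through ker phi (phantom_total). As ker phi is w (x) ker (cover M -> M),
    both traces factor through w-projective modules. On the other hand, if the
    identity of total is a trace from T then phi has a section (total_split),
    which is excluded if N is not pure projective.

    The difficulty is to see that the module induced from total to G is not
    w-projective. Over H, a w-projective module is projective relative to
    intersections of H with conjugates of Q, but these need not lie in T, and
    for T = P' and an arbitrary M the induced module can be w-projective: M may
    itself be induced from the intersection of P' with such a conjugate. So T
    has to be chosen. Call a map of modules over T negligible if it is a sum of
    a map that factors through a pure projective module and of traces from
    proper subgroups of T, and call T sensitive if, for some M, the identity of
    w (x) M is not negligible.

    Some subgroup is sensitive, as otherwise every w (x) M would be pure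
    projective, by induction on the order of the group (insensitive_pp). By the
    Mackey formula a sensitive subgroup T lies in a conjugate of Q
    (sensitive_sub), hence in a conjugate of P', and a conjugate of the cyclic
    factor provides Z (central_complement). Let T be a maximal sensitive
    subgroup. Then H is not sensitive, so if the induced module were
    w-projective, the identity of total would be negligible over H. Its terms
    are a trace from T and traces from subgroups that meet T properly up to
    conjugacy, and the latter are negligible over T (negligible_res_dprod).
    With total_split, the identity of N would be negligible over T
    (negligible_id_total), against the choice of T. *)

Set Implicit Arguments.
Unset Strict Implicit.
Unset Printing Implicit Defensive.

(** * Equivariant maps and relative traces *)

Section Generalities.
Import GRing.Theory.
Local Open Scope ring_scope.
Variable k : fieldType.

Section LinearFunctions.
Variables (U V : lmodType k) (f : U -> V).
Hypothesis f_lin : linear f.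

Lemma lin0 : f 0 = 0. Proof. exact: linear_fun0. Qed.

Lemma linD : {morph f : x y / x + y}.
Proof. by move=> x y; have := f_lin 1 x y; rewrite !scale1r. Qed.

Lemma linZ a : {morph f : x / a *: x}.
Proof. by move=> x; have := f_lin a x 0; rewrite lin0 !addr0. Qed.

Lemma linN : {morph f : x / - x}.
Proof. by move=> x; rewrite -!scaleN1r linZ. Qed.

Lemma linB : {morph f : x y / x - y}.
Proof. by move=> x y; rewrite linD linN. Qed.

Lemma lin_sum (I : Type) (r : seq I) (P : pred I) (F : I -> U) :
  f (\sum_(i <- r | P i) F i) = \sum_(i <- r | P i) f (F i).
Proof. exact: (big_morph f linD lin0). Qed.

End LinearFunctions.

Lemma linear_comp (U V W : lmodType k) (f : V -> W) (h : U -> V) :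
  linear f -> linear h -> linear (f \o h).
Proof. by move=> fl hl a x y; rewrite /= hl fl. Qed.

Lemma linear_add (U V : lmodType k) (f h : U -> V) :
  linear f -> linear h -> linear (f \+ h).
Proof. by move=> fl hl a x y; rewrite /= fl hl scalerDr addrACA. Qed.

Lemma linear_zero (U V : lmodType k) : linear (fun _ : U => 0 : V).
Proof. by move=> a x y; rewrite scaler0 addr0. Qed.

Lemma linear_bigsum (U V : lmodType k) (I : Type) (r : seq I) (P : pred I)
  (F : I -> U -> V) : (forall i, P i -> linear (F i)) ->
  linear (fun x => \sum_(i <- r | P i) F i x).
Proof.
move=> F_lin a x y; rewrite scaler_sumr -big_split /=.
by apply: eq_bigr => i /F_lin->.
Qed.

Variable gT : finGroupType.
Implicit Types B G K H T : {group gT}.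

Section Action.
Variables (G : {group gT}) (X : kGmod k G).
Implicit Types (x y : X) (g h : gT).

Lemma actD g : g \in G -> {morph kG_act g : x y / x + y : X}.
Proof. by move=> gG; apply/linD/kG_act_linear. Qed.

Lemma act_sum g (I : Type) (r : seq I) (P : pred I) (F : I -> X) : g \in G ->
  kG_act g (\sum_(i <- r | P i) F i) = \sum_(i <- r | P i) kG_act g (F i).
Proof. by move=> gG; apply/lin_sum/kG_act_linear. Qed.

Lemma actK g : g \in G -> cancel (kG_act g : X -> X) (kG_act g^-1).
Proof. by move=> gG x; rewrite -kG_actM ?groupV // mulVg kG_act1. Qed.

Lemma actVK g : g \in G -> cancel (kG_act g^-1 : X -> X) (kG_act g).
Proof. by move=> gG x; rewrite -kG_actM ?groupV // mulgV kG_act1. Qed.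

End Action.

(** The source and the target are modules over groups that may be larger than
    the set A for which the map is equivariant; this avoids writing
    restriction functors. *)
Definition hom_on (GX GY : {group gT}) (X : kGmod k GX) (Y : kGmod k GY)
    (A : {set gT}) (f : X -> Y) :=
  linear f /\ forall g, g \in A -> forall x, f (kG_act g x) = kG_act g (f x).

Section Homs.
Variables (GX GY GZ : {group gT}).
Variables (X : kGmod k GX) (Y : kGmod k GY) (Z : kGmod k GZ).

Lemma hom_on_sub (A A' : {set gT}) (f : X -> Y) :
  A' \subset A -> hom_on A f -> hom_on A' f.
Proof. by move=> /fintype.subsetP sA [fl fA]; split=> // g /sA; apply: fA. Qed.

Lemma hom_on_comp (A : {set gT}) (f : Y -> Z) (h : X -> Y) :
  hom_on A f -> hom_on A h -> hom_on A (f \o h).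
Proof.
move=> [fl fA] [hl hA]; split; first exact: linear_comp.
by move=> g gA x; rewrite /= hA // fA.
Qed.

Lemma hom_on_add (A : {set gT}) (f h : X -> Y) : A \subset GY ->
  hom_on A f -> hom_on A h -> hom_on A (f \+ h).
Proof.
move=> /fintype.subsetP sA [fl fA] [hl hA]; split; first exact: linear_add.
by move=> g gA x; rewrite /= fA // hA // actD // sA.
Qed.

Lemma hom_on_diff (A : {set gT}) (f h : X -> Y) : A \subset GY ->
  hom_on A f -> hom_on A h -> hom_on A (f \- h).
Proof.
move=> /fintype.subsetP sA [fl fA] [hl hA]; split=> [a x y|g gA x] /=.
  by rewrite fl hl opprD addrACA scalerBr.
by rewrite fA // hA // (linB (kG_act_linear (sA g gA))).
Qed.

Lemma hom_on_zero (A : {set gT}) : A \subset GY ->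
  hom_on A (fun _ : X => 0 : Y).
Proof.
move=> /fintype.subsetP sA; split=> [|g gA x]; first exact: linear_zero.
by rewrite lin0 //; apply/kG_act_linear/sA.
Qed.

(** Equivariance can be tested after an equivariant injection. *)
Lemma hom_on_inj (A : {set gT}) (i : Y -> Z) (f : X -> Y) :
  injective i -> hom_on A i -> linear f -> hom_on A (i \o f) -> hom_on A f.
Proof.
move=> i_inj [_ iA] fl [_ ifA]; split=> // g gA x.
by apply: i_inj; rewrite iA // -ifA.
Qed.

End Homs.

Section Trace.
Variables (GX GY : {group gT}) (X : kGmod k GX) (Y : kGmod k GY).

Definition conj_map (g : gT) (th : X -> Y) : X -> Y :=
  fun x => kG_act g (th (kG_act g^-1 x)).

(** For a B-map th the summand does not depend on the chosen representative of
    the coset, by conj_map_repr below. *)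
Definition rel_trace (B T : {set gT}) (th : X -> Y) : X -> Y :=
  fun x => \sum_(A in lcosets B T) conj_map (repr A) th x.

Lemma linear_conj_map g th :
  g \in GX -> g \in GY -> linear th -> linear (conj_map g th).
Proof.
move=> gX gY thl; apply: linear_comp; first exact: kG_act_linear.
by apply: linear_comp => //; apply/kG_act_linear; rewrite groupV.
Qed.

Lemma hom_on_conj_map (B : {set gT}) g th : B \subset GX -> B \subset GY ->
  g \in GX -> g \in GY -> hom_on B th -> hom_on (B :^ g^-1)%g (conj_map g th).
Proof.
move=> /fintype.subsetP sX /fintype.subsetP sY gX gY [thl thB].
split=> [|_ /imsetP[b bB ->] x]; first exact: linear_conj_map.
have bgX : (b ^ g^-1)%g \in GX := groupJ (sX _ bB) (groupVr gX).
have bgY : (b ^ g^-1)%g \in GY := groupJ (sY _ bB) (groupVr gY).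
have e1 : (g^-1 * b ^ g^-1 = b * g^-1)%g.
  by rewrite conjgE invgK mulKg.
have e2 : (b ^ g^-1 * g = g * b)%g by rewrite conjgE invgK mulgA mulgKV.
have [bX bY] := (sX _ bB, sY _ bB).
rewrite /conj_map -kG_actM ?groupV // e1 kG_actM ?groupV // thB //.
by rewrite -!kG_actM // e2.
Qed.

Lemma repr_lcoset (B : {group gT}) g : exists2 b, b \in B & repr (g *: B)%g = (g * b)%g.
Proof. by apply/lcosetP/(mem_repr g)/lcoset_refl. Qed.

Lemma repr_lcosets (B T : {group gT}) (A : {set gT}) :
  A \in lcosets B T -> B \subset T ->
  (repr A \in T) /\ A = (repr A *: B)%g.
Proof.
move=> /lcosetsP[g gT' ->] sBT; have [b bB e] := repr_lcoset B g.
have bT := fintype.subsetP sBT _ bB.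
by rewrite e lcosetM (lcoset_id bB) groupM.
Qed.

Section TraceTheory.
Variables (B T : {group gT}) (th : X -> Y).
Hypotheses (sBT : B \subset T) (sTX : T \subset GX) (sTY : T \subset GY).
Hypothesis th_hom : hom_on B th.
Let BT := fintype.subsetP sBT.
Let TX := fintype.subsetP sTX.
Let TY := fintype.subsetP sTY.

Lemma conj_mapMr g b : g \in T -> b \in B ->
  conj_map (g * b)%g th =1 conj_map g th.
Proof.
move=> gT' bB x; have bT := BT bB; case: th_hom => _ thB.
rewrite /conj_map invMg kG_actM ?TY // kG_actM ?groupV ?TX //.
by rewrite -thB // actVK ?TX.
Qed.

Lemma conj_map_repr g : g \in T ->
  conj_map (repr (g *: B)%g) th =1 conj_map g th.
Proof.
by move=> gT' x; have [b bB ->] := repr_lcoset B g; apply: conj_mapMr.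
Qed.

Lemma conj_mapM g h x : g \in T -> h \in T ->
  conj_map (g * h)%g th x = conj_map g (conj_map h th) x.
Proof.
move=> gT' hT; rewrite /conj_map invMg.
by rewrite !kG_actM ?groupV ?TX ?TY.
Qed.

Lemma hom_on_tr : hom_on T (rel_trace B T th).
Proof.
have [thl _] := th_hom; split=> [|g gT' x].
  apply: linear_bigsum => A /repr_lcosets[] // rT _.
  by apply: linear_conj_map; rewrite ?TX ?TY.
rewrite /rel_trace act_sum ?TY //.
rewrite (reindex_inj (@lcoset_inj _ g)) /=; apply: eq_big => [A|A].
  apply/idP/idP => [/lcosetsP[y yT /(congr1 (lcoset^~ g^-1%g))]|].
    rewrite !lcosetE lcosetK -lcosetM => ->; apply/lcosetsP.
    by exists (g^-1 * y)%g; rewrite // groupM ?groupV.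
  case/lcosetsP=> y yT ->; apply/lcosetsP.
  by exists (g * y)%g; rewrite ?groupM // lcosetM.
move=> /lcosetsP[y yT e].
rewrite e conj_map_repr //.
have -> : A = ((g^-1 * y) *: B)%g by rewrite lcosetM -e lcosetK.
have gyT : (g^-1 * y)%g \in T by rewrite groupM ?groupV.
rewrite conj_map_repr // -{1}[y](mulKVg g) conj_mapM //.
by rewrite /conj_map actK ?TX.
Qed.
End TraceTheory.
End Trace.
End Generalities.

Section TraceCalculus.
Import GRing.Theory.
Local Open Scope ring_scope.
Variables (k : fieldType) (gT : finGroupType).

Section Linearity.
Variables (GX GY GZ : {group gT}).
Variables (X : kGmod k GX) (Y : kGmod k GY) (Z : kGmod k GZ).
Variables (B T : {group gT}).
Hypothesis sBT : B \subset T.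

Lemma tr_add (th th' : X -> Y) : T \subset GY ->
  rel_trace B T (th \+ th') =1 rel_trace B T th \+ rel_trace B T th'.
Proof.
move=> /fintype.subsetP sTY x; rewrite /rel_trace /= -big_split /=.
apply: eq_bigr => A /repr_lcosets[] // /sTY rY _.
by rewrite /conj_map /= actD.
Qed.

Lemma tr_compl (h : Y -> Z) (th : X -> Y) : hom_on T h ->
  rel_trace B T (h \o th) =1 h \o rel_trace B T th.
Proof.
move=> [hl hT] x; rewrite /rel_trace /= lin_sum //; apply: eq_bigr => A.
by move=> /repr_lcosets[] // rT _; rewrite /conj_map /= hT.
Qed.

Lemma tr_compr (th : Y -> Z) (h : X -> Y) : hom_on T h ->
  rel_trace B T (th \o h) =1 rel_trace B T th \o h.
Proof.
move=> [hl hT] x; rewrite /rel_trace /=; apply: eq_bigr => A.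
by move=> /repr_lcosets[] // rT _; rewrite /conj_map /= hT // groupV.
Qed.

End Linearity.

Section Mackey.
Variables (GX GY : {group gT}) (X : kGmod k GX) (Y : kGmod k GY).

(** The Mackey formula, for a class P of maps closed under sums: the orbit
    of gB under T in H / B is T / (T n gBg^-1), so restricting a trace from B
    to T gives a sum of traces from the subgroups T n gBg^-1. *)
Lemma mackey (T B H : {group gT}) (th : X -> Y) (P : (X -> Y) -> Prop) :
  T \subset H -> B \subset H -> H \subset GX -> H \subset GY -> hom_on B th ->
  P (fun=> 0) -> (forall f h, P f -> P h -> P (f \+ h)) ->
  (forall g, g \in H -> P (rel_trace (T :&: B :^ g^-1)%g T (conj_map g th))) ->
  P (rel_trace B H th).
Proof.
move=> sTH sBH sHX sHY thB P0 PD PT.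
pose F (S : {set {set gT}}) (x : X) := \sum_(A in S) conj_map (repr A) th x.
suff PF n (S : {set {set gT}}) : (#|S| < n)%N -> S \subset lcosets B H ->
    (forall t A, t \in T -> A \in S -> (t *: A)%g \in S) -> P (F S).
  apply: (PF _ (lcosets B H) (ltnSn _)) => // t A tT /lcosetsP[g gH ->].
  apply/lcosetsP; exists (t * g)%g; last by rewrite lcosetM.
  by rewrite groupM // (fintype.subsetP sTH).
elim: n S => // n IH S ltSn sS ST; have [S0|[A AS]] := set_0Vmem S.
  by rewrite (_ : F S = fun=> 0) //; apply/funext => x; rewrite /F S0 big_set0.
have [g gH defA] : exists2 g, g \in H & A = (g *: B)%g.
  by apply/lcosetsP/(fintype.subsetP sS).
pose O := [set (t *: A)%g | t in T].
have sOS : O \subset S.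
  by apply/fintype.subsetP=> _ /imsetP[t tT ->]; apply: ST.
have AO : A \in O by apply/imsetP; exists 1%g; rewrite // lcoset1.
have -> : F S = F O \+ F (S :\: O).
  apply/funext => x; rewrite /F /= (big_setID O) /=.
  by congr (_ + _); apply: eq_bigl => C; rewrite (finset.setIidPr sOS).
apply: PD; last first.
  apply: IH => [|| t C tT /setDP[CS CO]].
  - rewrite ltnS in ltSn; apply: leq_trans ltSn; rewrite (cardsD1 A S) AS add1n ltnS.
    by apply/subset_leq_card/setDS; rewrite sub1set.
  - exact: subset_trans (subsetDl _ _) sS.
  apply/setDP; split; first exact: ST.
  apply: contra CO => /imsetP[t' t'T e]; apply/imsetP.
  exists (t^-1 * t')%g; first by rewrite groupM ?groupV.
  by rewrite lcosetM -e lcosetK.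
rewrite (_ : F O = rel_trace (T :&: B :^ g^-1)%g T (conj_map g th)); first exact: PT.
apply/funext => x; rewrite /F /rel_trace.
set D := (T :&: B :^ g^-1)%G.
have sDT : D \subset T by apply: subsetIl.
have TH := fintype.subsetP sTH.
have thD : hom_on D (conj_map g th).
  apply: hom_on_sub (subsetIr _ _) _; apply: hom_on_conj_map => //.
  - exact: subset_trans sHX.
  - exact: subset_trans sHY.
  - exact: (fintype.subsetP sHX).
  - exact: (fintype.subsetP sHY).
have -> : O = [set (repr C *: A)%g | C in lcosets D T].
  apply/setP => C; apply/imsetP/imsetP => -[].
    move=> t tT ->; exists (t *: D)%g; first by apply/lcosetsP; exists t.
    have [d dD ->] := repr_lcoset D t.
    have /setIP[_] := dD; rewrite mem_conjg invgK => dB.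
    rewrite lcosetM; congr (_ *: _)%g; rewrite defA -lcosetM.
    by rewrite conjgC lcosetM (lcoset_id dB).
  by move=> E /repr_lcosets[] // rT _ ->; exists (repr E).
rewrite big_imset /=; last first.
  move=> C E /(repr_lcosets)[] // rC defC /repr_lcosets[] // rE defE.
  rewrite defA -!lcosetM => /(congr1 (fun U : {set gT} => (repr C * g)%g \in U)).
  rewrite lcoset_refl => /esym; rewrite mem_lcoset => cB.
  rewrite defC defE; apply/lcoset_eqP; rewrite mem_lcoset inE groupM ?groupV //=.
  rewrite mem_conjg invgK.
  by rewrite conjgE !mulgA -[(_ * (repr E)^-1)%g]invMg -!mulgA.
apply: eq_bigr => C /repr_lcosets[] // rC _; rewrite defA -lcosetM.
rewrite (conj_map_repr sBH sHX sHY) ?groupM ?(TH _ rC) //.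
by rewrite (conj_mapM _ sHX sHY) ?(TH _ rC).
Qed.

End Mackey.

(** ev and ext behave like the projection of an induced module onto its
    summand 1 (x) V and the inclusion of this summand. *)
Definition induced_by (B T : {group gT}) (GV GU : {group gT}) (V : kGmod k GV)
    (U : kGmod k GU) (ext : V -> U) (ev : U -> V) :=
  [/\ hom_on B ext, hom_on B ev &
      forall g v, g \in T ->
        ev (kG_act g (ext v)) = if g \in B then kG_act g v else 0].

(** The trace of a map through V factors through the induced module of V,
    because the mixed terms of the product of the two traces vanish. *)
Lemma tr_induced (B T GX GY GV GU : {group gT}) (X : kGmod k GX)
    (Y : kGmod k GY) (V : kGmod k GV) (U : kGmod k GU)
    (ext : V -> U) (ev : U -> V) (a : X -> V) (b : V -> Y) :
  B \subset T -> T \subset GU -> T \subset GY -> B \subset GV ->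
  induced_by B T ext ev -> linear b ->
  rel_trace B T (b \o a) =1 rel_trace B T (b \o ev) \o rel_trace B T (ext \o a).
Proof.
move=> sBT sTU sTY sBV [[extl _] [evl _] evE] bl x.
rewrite /rel_trace /=; apply: eq_bigr => A AB.
have [rA defA] := repr_lcosets AB sBT.
have TU := fintype.subsetP sTU.
have TY := fintype.subsetP sTY.
rewrite /conj_map /= act_sum ?groupV ?TU // lin_sum // lin_sum //.
rewrite act_sum ?TY // (bigD1 A) //= big1 ?addr0 => [|C /andP[CB neqCA]].
  rewrite -kG_actM ?groupV ?TU // mulVg evE // group1 kG_act1.
  by [].
have [rC defC] := repr_lcosets CB sBT.
have rAC : ((repr A)^-1 * repr C)%g \in T by rewrite groupM ?groupV.
rewrite -kG_actM ?groupV ?TU // evE // ifN; first by rewrite lin0 // lin0 //; apply/kG_act_linear/TY.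
apply: contra neqCA => ACB; rewrite defA defC eq_sym; apply/eqP.
by apply/esym/lcoset_eqP; rewrite mem_lcoset.
Qed.

End TraceCalculus.

(** * Finite dimensional modules *)

Section FiniteDimension.
Import GRing.Theory.
Local Open Scope ring_scope.
Variable k : fieldType.

Lemma lspan_min (V : lmodType k) (S : V -> Prop) (P : V -> Prop) :
  P 0 -> (forall a u v, P u -> P v -> P (a *: u + v)) ->
  (forall v, S v -> P v) -> forall v, v \in lspan S -> P v.
Proof.
move=> P0 PD SP v /asboolP; elim=> // a u {}v /SP Pu _ Pv; exact: PD.
Qed.

Definition finspan (V : lmodType k) :=
  exists s : seq V, forall v, v \in lspan (fun x => x \in s).

Definition lcomb (V : lmodType k) n (e : 'I_n -> V) (c : 'rV[k]_n) :=
  \sum_j c ord0 j *: e j.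

Lemma lcomb_linear (V : lmodType k) n (e : 'I_n -> V) : linear (lcomb e).
Proof.
move=> a c d; rewrite /lcomb scaler_sumr -big_split /=.
by apply: eq_bigr => j _; rewrite !mxE scalerDl scalerA.
Qed.

Lemma lcomb_span (V : lmodType k) n (e : 'I_n -> V) (S : V -> Prop) v :
  (forall x, S x -> exists j, x = e j) -> v \in lspan S ->
  exists c, v = lcomb e c.
Proof.
move=> Se; move: v; apply: (lspan_min (P := fun v => exists c, v = lcomb e c)).
- by exists 0; rewrite (lin0 (lcomb_linear e)).
- by move=> a _ _ [c ->] [d ->]; exists (a *: c + d); rewrite lcomb_linear.
move=> v /Se[j ->].
exists (delta_mx ord0 j); rewrite /lcomb (bigD1 j) //= mxE !eqxx scale1r.
by rewrite big1 ?addr0 // => i /negPf nij; rewrite mxE eqxx nij scale0r.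
Qed.

(** A generating family of minimal length is a basis: a relation between its
    members would let one of them be dropped. *)
Lemma finspan_axiom (V : lmodType k) :
  finspan V -> exists n, inhabited (Vector.axiom n V).
Proof.
move=> [s0 span0].
pose P m := `[< exists s : seq V,
  size s = m /\ forall v, v \in lspan (fun x => x \in s) >].
have exP : exists m, P m by exists (size s0); apply/asboolP; exists s0.
case: (ex_minnP exP) => n /asboolP[s [sz_s span_s]] min_s.
pose e (j : 'I_n) := s`_j.
have e_span v : exists c, v = lcomb e c.
  apply: lcomb_span (span_s v) => x xs.
  have ltxs : (index x s < n)%N by rewrite -sz_s index_mem.
  by exists (Ordinal ltxs); rewrite /e /= nth_index.
have e_inj c : lcomb e c = 0 -> c = 0.
  move=> c0; apply/rowP => j; rewrite mxE; apply/eqP/negPn/negP => cj.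
  pose s' := [seq e i | i <- enum 'I_n & i != j].
  have /min_s : P (size s').
    apply/asboolP; exists s'; split=> // v; have [d ->] := e_span v.
    have in_s' i : i != j -> e i \in lspan (fun x => x \in s').
      move=> nij; apply: mem_lspan; apply/mapP; exists i => //.
      by rewrite mem_filter nij mem_enum.
    rewrite /lcomb; apply: rpred_sum => i _; apply: rpredZ.
    have [->|/in_s'//] := eqVneq i j.
    have -> : e j = - (c ord0 j)^-1 *: \sum_(i | i != j) c ord0 i *: e i.
      move: c0; rewrite /lcomb (bigD1 j) //= => /eqP; rewrite addr_eq0 => /eqP e0.
      by rewrite scaleNr -scalerN -[- _]e0 scalerA mulVf // scale1r.
    by apply: rpredZ; apply: rpred_sum => i' /in_s'; apply: rpredZ.
  rewrite size_map size_filter leqNgt => /negP; apply.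
  rewrite -[X in (_ < X)%N](size_enum_ord n) -(count_predC (pred1 j)).
  rewrite -[X in (X < _)%N]add0n ltn_add2r -has_count; apply/hasP.
  by exists j; rewrite ?mem_enum //=.
have [r rP] := choice e_span.
have rK : cancel (lcomb e) r.
  move=> c; apply/eqP; rewrite -subr_eq0; apply/eqP/e_inj.
  by rewrite (linB (lcomb_linear e)) -rP subrr.
exists n; constructor; exists r; last by exists (lcomb e).
move=> a u v; rewrite [in LHS](rP u) [in LHS](rP v) -lcomb_linear.
by rewrite rK.
Qed.

(** Coordinates give explicit inverses of natural maps out of tensor products
    with V, which avoids the dual of V. *)
Lemma findim_frame (V : lmodType k) n : Vector.axiom n V ->
  exists (e : 'I_n -> V) (c : 'I_n -> V -> k),
    (forall j, linear (c j : V -> k^o)) /\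
    forall u, u = \sum_j c j u *: e j.
Proof.
case=> r r_lin [r' rK r'K].
have r'_lin : linear r' by move=> a u v; apply: (can_inj rK); rewrite r_lin !r'K.
exists (fun j => r' (delta_mx ord0 j)), (fun j u => r u ord0 j); split.
  by move=> j a u v; rewrite r_lin !mxE.
move=> u; rewrite -[LHS]rK [r u in LHS]row_sum_delta lin_sum //.
by apply: eq_bigr => j _; rewrite linZ.
Qed.

Lemma findim_finspan (V : lmodType k) n : Vector.axiom n V -> finspan V.
Proof.
move=> /findim_frame[e [c [_ eV]]]; exists [seq e j | j : 'I_n] => v.
rewrite [v]eV; apply: rpred_sum => j _; apply/rpredZ/mem_lspan.
exact: map_f (mem_enum _ _).
Qed.

End FiniteDimension.

(** * Maps of tensor products and direct sums *)

Section Constructions.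
Import GRing.Theory.
Local Open Scope ring_scope.
Variables (k : fieldType) (gT : finGroupType).

Section TensorMap.
Variables (G G' : {group gT}) (X Y : kGmod k G) (X' Y' : kGmod k G').
Variables (f : X -> X') (h : Y -> Y').
Hypotheses (f_lin : linear f) (h_lin : linear h).

Definition tmap : kG_tensor X Y -> kG_tensor X' Y' :=
  tensor_lift (fun x y => tens (f x) (h y)).

Lemma tmap_linear : linear tmap.
Proof.
apply: tensor_lift_linear => [y|x] a u v.
  by rewrite f_lin tens_linear_l.
by rewrite h_lin tens_linear_r.
Qed.

Lemma tmapE x y : tmap (tens x y) = tens (f x) (h y).
Proof.
apply: tensor_liftE => [{}y|{}x] a u v.
  by rewrite f_lin tens_linear_l.
by rewrite h_lin tens_linear_r.
Qed.

End TensorMap.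

Lemma act_tens (G : {group gT}) (X Y : kGmod k G) g (x : X) (y : Y) : g \in G ->
  kG_act g (tens x y : kG_tensor X Y) = tens (kG_act g x) (kG_act g y).
Proof. exact: tensor_actE. Qed.

Lemma hom_on_tmap (G G' : {group gT}) (X Y : kGmod k G) (X' Y' : kGmod k G')
    (A : {set gT}) (f : X -> X') (h : Y -> Y') :
  A \subset G -> A \subset G' -> hom_on A f -> hom_on A h ->
  hom_on A (tmap f h).
Proof.
move=> /fintype.subsetP sG /fintype.subsetP sG' [fl fA] [hl hA].
split=> [|g gA]; first exact: tmap_linear.
have [gG gG'] := (sG g gA, sG' g gA).
have al := @kG_act_linear _ _ _ (kG_tensor X Y) _ gG.
have al' := @kG_act_linear _ _ _ (kG_tensor X' Y') _ gG'.
apply: tensor_eq => [||x y].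
- exact: linear_comp (tmap_linear fl hl) al.
- exact: linear_comp al' (tmap_linear fl hl).
by rewrite act_tens // !tmapE // act_tens // fA // hA.
Qed.

Lemma tmap_comp (G1 G2 G3 : {group gT}) (X1 Y1 : kGmod k G1)
    (X2 Y2 : kGmod k G2) (X3 Y3 : kGmod k G3)
    (f : X2 -> X3) (f' : X1 -> X2) (h : Y2 -> Y3) (h' : Y1 -> Y2) :
  linear f -> linear f' -> linear h -> linear h' ->
  tmap f h \o tmap f' h' =1 tmap (f \o f') (h \o h').
Proof.
move=> fl f'l hl h'l; apply: tensor_eq => [||x y].
- by apply: linear_comp; exact: tmap_linear.
- by apply: tmap_linear; exact: linear_comp.
by rewrite /= !tmapE //; exact: linear_comp.
Qed.

Lemma tmap_id (G : {group gT}) (X Y : kGmod k G) (f : X -> X) (h : Y -> Y) :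
  f =1 id -> h =1 id -> tmap f h =1 id.
Proof.
move=> fE hE; have fl : linear f by move=> a u v; rewrite !fE.
have hl : linear h by move=> a u v; rewrite !hE.
apply: tensor_eq => [||x y] //; first exact: tmap_linear.
by rewrite tmapE // fE hE.
Qed.

Section Coordinates.
Variables (G : {group gT}) (X Y : kGmod k G).
Variables (n : nat) (e : 'I_n -> X) (c : 'I_n -> X -> k).
Hypotheses (c_lin : forall j, linear (c j : X -> k^o))
  (eX : forall u, u = \sum_j c j u *: e j).

Definition tcoord j : kG_tensor X Y -> Y :=
  tensor_lift (fun x y => c j x *: y).

Let c_bilin_l j y : linear (fun x => c j x *: y : Y).
Proof. by move=> a u v; rewrite c_lin scalerDl scalerA. Qed.

Let c_bilin_r j x : linear (fun y : Y => c j x *: y).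
Proof. by move=> a u v; rewrite scalerDr !scalerA mulrC. Qed.

Lemma tcoord_linear j : linear (tcoord j).
Proof. by apply: tensor_lift_linear; [exact: c_bilin_l|exact: c_bilin_r]. Qed.

Lemma tcoordE j x y : tcoord j (tens x y) = c j x *: y.
Proof.
by apply: (tensor_liftE (b := fun x y => c j x *: y));
  [exact: c_bilin_l|exact: c_bilin_r].
Qed.

Lemma tcoord_sum (t : kG_tensor X Y) : t = \sum_j tens (e j) (tcoord j t).
Proof.
move: t; apply: (tensor_eq (f := id)) => [||x y] //.
  apply: linear_bigsum => j _.
  exact: linear_comp (@tens_linear_r _ _ _ X Y (e j)) (tcoord_linear j).
rewrite {1}[x]eX (lin_sum (@tens_linear_l _ _ _ X Y y)).
apply: eq_bigr => j _.
by rewrite tcoordE (linZ (@tens_linear_l _ _ _ X Y y))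
           (linZ (@tens_linear_r _ _ _ X Y (e j))).
Qed.

End Coordinates.

Lemma tcoord_tmap (G G' : {group gT}) (X Y : kGmod k G) (X' Y' : kGmod k G')
    n (c : 'I_n -> X -> k) (c' : 'I_n -> X' -> k) (f : X -> X') (h : Y -> Y') j t :
  (forall j, linear (c j : X -> k^o)) -> (forall j, linear (c' j : X' -> k^o)) ->
  (forall x, c' j (f x) = c j x) -> linear f -> linear h ->
  tcoord c' j (tmap f h t) = h (tcoord c j t).
Proof.
move=> cl c'l cf fl hl; move: t.
apply: (tensor_eq (f := tcoord c' j \o tmap f h) (h := h \o tcoord c j)).
- by apply: linear_comp; [exact: tcoord_linear|exact: tmap_linear].
- by apply: linear_comp => //; exact: tcoord_linear.
by move=> x y; rewrite /= tmapE // !tcoordE // linZ // cf.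
Qed.

Section DirectSums.
Variables (G G' : {group gT}) (I : Type).
Variables (F : I -> kGmod k G) (F' : I -> kGmod k G').

Section Map.
Variable f : forall i, F i -> F' i.
Arguments f : clear implicits.
Hypothesis f_lin : forall i, linear (f i).

Lemma dsum_map_subproof (x : kG_dsum F) :
  ((fun i => f i (x i)) : Defs.dprod F') \in @fin_supp _ _ _ _ F'.
Proof.
have /asboolP fx := dsum_valP x; apply/asboolP.
by apply: sub_finite_set fx => i /=; apply: contra_neq; rewrite /dsum_fun => ->;
   exact: lin0.
Qed.

Definition dsum_map (x : kG_dsum F) : kG_dsum F' := DSum (dsum_map_subproof x).

Lemma hom_on_dsum_map (A : {set gT}) : A \subset G -> A \subset G' ->
  (forall i, hom_on A (f i)) -> hom_on A dsum_map.
Proof.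
move=> /fintype.subsetP sG /fintype.subsetP sG' fA; split=> [a x y|g gA x].
  by apply: dsum_eq => i; exact: f_lin.
apply: dsum_eq => i; rewrite [RHS]dsum_actE ?sG' //.
by have [_ <- //] := fA i; rewrite -[LHS]/(f i (kG_act g x i)) [kG_act g x i]dsum_actE ?sG.
Qed.

End Map.

Lemma dsum_proj_hom i : hom_on G (fun x : kG_dsum F => x i).
Proof. by split=> // g gG x; rewrite [LHS]dsum_actE. Qed.

End DirectSums.

Section DirectSumLift.
Variables (G G' : {group gT}) (I : eqType) (F : I -> kGmod k G).
Variables (Y : kGmod k G') (f : forall i, F i -> Y).
Arguments f : clear implicits.
Hypothesis f_lin : forall i, linear (f i).

Lemma dsum_supp (x : kG_dsum F) :
  exists s : seq I, uniq s /\ forall i, x i != 0 -> i \in s.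
Proof.
have /asboolP/finite_seqP[s e] := dsum_valP x.
exists (undup s); split=> [|i nz]; first exact: undup_uniq.
by rewrite mem_undup; have : [set` s]%classic i by rewrite -e.
Qed.

(** The list is an arbitrary enumeration of a finite set containing the
    support of x; by dsum_liftE the sum does not depend on it. *)
Definition dsum_lift (x : kG_dsum F) : Y :=
  \sum_(i <- projT1 (cid (dsum_supp x))) f i (x i).

Lemma dsum_liftE (x : kG_dsum F) s : uniq s -> (forall i, x i != 0 -> i \in s) ->
  dsum_lift x = \sum_(i <- s) f i (x i).
Proof.
rewrite /dsum_lift; case: cid => s' /= [Us' s'P] Us sP.
have supp r : \sum_(i <- r) f i (x i) = \sum_(i <- [seq i <- r | x i != 0]) f i (x i).
  rewrite big_filter [RHS]big_mkcond; apply: eq_bigr => i _.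
  by case: eqP => // ->; exact: lin0.
rewrite supp [RHS]supp; apply: perm_big; apply: uniq_perm; rewrite ?filter_uniq //.
move=> i; rewrite !mem_filter; case: eqP => //= /eqP nz.
by rewrite sP ?s'P.
Qed.

Lemma hom_on_dsum_lift (A : {set gT}) : A \subset G -> A \subset G' ->
  (forall i, hom_on A (f i)) -> hom_on A dsum_lift.
Proof.
move=> /fintype.subsetP sG /fintype.subsetP sG' fA.
split=> [a x y|g gA x].
  have [[s [Us sP]] [s' [Us' s'P]]] := (dsum_supp x, dsum_supp y).
  pose r := undup (s ++ s').
  have rE (z : kG_dsum F) : (forall i, z i != 0 -> (i \in s) || (i \in s')) ->
      dsum_lift z = \sum_(i <- r) f i (z i).
    move=> zP; apply: dsum_liftE => [|i /zP]; first exact: undup_uniq.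
    by rewrite mem_undup mem_cat.
  rewrite !rE => [|i /s'P->|i /sP->|i nz]; rewrite ?orbT //.
    rewrite scaler_sumr -big_split /=; apply: eq_bigr => i _.
    by rewrite -[LHS]/(f i (a *: x i + y i)) f_lin.
  have [x0|/sP->//] := eqVneq (x i) 0; rewrite s'P ?orbT //.
  by apply: contra_neq nz => y0; rewrite -[LHS]/(a *: x i + y i) x0 y0 scaler0 addr0.
have [s [Us sP]] := dsum_supp x.
have gE i : (kG_act g x : kG_dsum F) i = kG_act g (x i).
  by rewrite [LHS]dsum_actE ?sG.
rewrite (@dsum_liftE _ s) // => [|i].
  rewrite (@dsum_liftE x s) // act_sum ?sG' //; apply: eq_bigr => i _.
  by rewrite gE; have [_ ->] := fA i.
by rewrite gE => nz; apply: sP; apply: contra_neq nz => ->; rewrite lin0 //;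
   apply/kG_act_linear/sG.
Qed.

End DirectSumLift.

Section DirectSumInclusion.
Variables (G : {group gT}) (I : eqType) (F : I -> kGmod k G) (i0 : I).

Definition dsum_in_fun (v : F i0) : Defs.dprod F :=
  fun i => if @eqP _ i0 i is ReflectT e then ecast j (F j) e v else 0.

Lemma dsum_in_fun_eq v : dsum_in_fun v i0 = v.
Proof. by rewrite /dsum_in_fun; case: eqP => // e; rewrite eq_axiomK. Qed.

Lemma dsum_in_fun_neq v i : i != i0 -> dsum_in_fun v i = 0.
Proof. by move=> /eqP ni; rewrite /dsum_in_fun; case: eqP => // e; case: ni. Qed.

Lemma dsum_in_subproof v : dsum_in_fun v \in @fin_supp _ _ _ _ F.
Proof.
apply/asboolP; apply: (@sub_finite_set _ _ [set i0]%classic); last exact: finite_set1.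
by move=> i /=; apply: contra_neqP => /eqP/(dsum_in_fun_neq v).
Qed.

Definition dsum_in v : kG_dsum F := DSum (dsum_in_subproof v).

Lemma hom_on_dsum_in : hom_on G dsum_in.
Proof.
split=> [a u v|g gG v]; apply: dsum_eq => i; have [->|ni] := eqVneq i i0.
- rewrite -[RHS]/(a *: dsum_in u i0 + dsum_in v i0).
  by rewrite /dsum_in /= /dsum_fun /= !dsum_in_fun_eq.
- rewrite -[RHS]/(a *: dsum_in u i + dsum_in v i).
  by rewrite /dsum_in /= /dsum_fun /= !dsum_in_fun_neq // scaler0 addr0.
- by rewrite [RHS]dsum_actE // /dsum_in /= /dsum_fun /= !dsum_in_fun_eq.
rewrite [RHS]dsum_actE // /dsum_in /= /dsum_fun /= !dsum_in_fun_neq // lin0 //.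
exact: kG_act_linear.
Qed.

Lemma dsum_lift_in (G' : {group gT}) (Y : kGmod k G') (f : forall i, F i -> Y) v :
  (forall i, linear (f i)) -> dsum_lift f (dsum_in v) = f i0 v.
Proof.
move=> f_lin; rewrite (@dsum_liftE _ _ _ _ _ _ f_lin _ [:: i0]) // => [|i].
  by rewrite big_seq1 /dsum_in /dsum_fun /= dsum_in_fun_eq.
rewrite inE; apply: contra_neqT => ni; exact: dsum_in_fun_neq.
Qed.

End DirectSumInclusion.

(** Tensoring with a finite dimensional module commutes with direct sums. In
    coordinates the inverse of the natural map needs no sum over the index
    type, only one over a basis of W. *)
Section Distribute.
Variables (G : {group gT}) (W : kGmod k G) (I : Type) (F : I -> kGmod k G).
Variables (n : nat) (e : 'I_n -> W) (c : 'I_n -> W -> k).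
Hypotheses (c_lin : forall j, linear (c j : W -> k^o))
  (eW : forall u, u = \sum_j c j u *: e j).

Let WF i := kG_tensor W (F i).

Let b_lin (x : W) i : linear (tens x : F i -> WF i).
Proof. exact: tens_linear_r. Qed.

Let b (x : W) (y : kG_dsum F) : kG_dsum WF := dsum_map (b_lin x) y.

Let b_bilin_l y : linear (b^~ y).
Proof. by move=> a u v; apply: dsum_eq => i; exact: tens_linear_l. Qed.

Let b_bilin_r x : linear (b x).
Proof. by move=> a u v; apply: dsum_eq => i; exact: tens_linear_r. Qed.

Definition distr : kG_tensor W (kG_dsum F) -> kG_dsum WF := tensor_lift b.

Lemma distrE x y i : distr (tens x y) i = tens x (y i).
Proof. by rewrite /distr tensor_liftE. Qed.

Lemma hom_on_distr : hom_on G distr.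
Proof.
have dl : linear distr by exact: tensor_lift_linear.
split=> // g gG.
have al := @kG_act_linear _ _ _ (kG_tensor W (kG_dsum F)) _ gG.
have al' := @kG_act_linear _ _ _ (kG_dsum WF) _ gG.
apply: tensor_eq => [||x y]; [exact: linear_comp|exact: linear_comp|].
apply: dsum_eq => i; rewrite act_tens // distrE [RHS]dsum_actE // distrE act_tens //.
by apply: (congr1 (tens (kG_act g x))); exact: dsum_actE.
Qed.

Definition codistr (d : kG_dsum WF) : kG_tensor W (kG_dsum F) :=
  \sum_j tens (e j) (dsum_map (fun i => @tcoord_linear _ W (F i) _ _ c_lin j) d).

Lemma distrK : cancel distr codistr.
Proof.
have [dl _] := hom_on_distr.
have ml j := (@hom_on_dsum_map _ _ _ _ _ _
  (fun i => @tcoord_linear _ W (F i) _ _ c_lin j) _ (sub0set _) (sub0set _)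
  (fun i => conj (@tcoord_linear _ W (F i) _ _ c_lin j)
     (fun g gA => False_ind _ (elimF idP (in_set0 g) gA)))).1.
have cl : linear codistr.
  apply: linear_bigsum => j _.
  exact: linear_comp (@tens_linear_r _ _ _ W (kG_dsum F) (e j)) (ml j).
apply: (tensor_eq (f := codistr \o distr) (h := id)) => // [|x y].
  exact: linear_comp.
rewrite /= {2}[x]eW (lin_sum (@tens_linear_l _ _ _ W (kG_dsum F) y)).
apply: eq_bigr => j _.
rewrite (linZ (@tens_linear_l _ _ _ W (kG_dsum F) y)).
rewrite -(linZ (@tens_linear_r _ _ _ W (kG_dsum F) (e j))).
suff -> : dsum_map (fun i => tcoord_linear c_lin j) (distr (tens x y)) = c j x *: y by [].
by apply: dsum_eq => i; rewrite /dsum_map {1}/dsum_fun /= distrE tcoordE.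
Qed.

Lemma codistrK : cancel codistr distr.
Proof.
have [dl _] := hom_on_distr.
move=> d; apply: dsum_eq => i; rewrite /codistr lin_sum //.
have [pl _] := @dsum_proj_hom G I WF i.
rewrite (lin_sum pl) [RHS](tcoord_sum c_lin eW).
by apply: eq_bigr => j _; rewrite distrE.
Qed.

Lemma hom_on_codistr : hom_on G codistr.
Proof.
apply: (hom_on_inj (can_inj distrK) hom_on_distr).
  by move=> a u v; apply: (can_inj distrK); rewrite (proj1 hom_on_distr) !codistrK.
by split=> [a u v|g gG u] /=; rewrite !codistrK.
Qed.

End Distribute.

End Constructions.

(** * Submodules and induced modules *)

Section Submodules.
Import GRing.Theory.
Local Open Scope ring_scope.
Variables (k : fieldType) (gT : finGroupType) (G : {group gT}) (X : kGmod k G).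

Definition submod_pred (S : {pred X}) (S_sub : submod_closed S) : {pred X} := S.
HB.instance Definition _ S S_sub :=
  GRing.isSubmodClosed.Build k X (@submod_pred S S_sub) S_sub.

Variables (S : {pred X}) (S_sub : submod_closed S).
Hypothesis S_act : forall g x, g \in G -> x \in S -> kG_act g x \in S.

Record sub_sort :=
  SubElt { sub_val : X; sub_valP : sub_val \in submod_pred S_sub }.
HB.instance Definition _ := [isSub for sub_val].
HB.instance Definition _ := [Choice of sub_sort by <:].
HB.instance Definition _ := [SubChoice_isSubLmodule of sub_sort by <:].

Definition sub_act g (x : sub_sort) : sub_sort := insubd x (kG_act g (val x)).

Lemma val_sub_act g x : g \in G -> val (sub_act g x) = kG_act g (val x).
Proof. by move=> gG; rewrite insubdK //; apply: S_act => //; apply: sub_valP. Qed.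

Lemma sub_val_linear : linear (val : sub_sort -> X).
Proof. by []. Qed.

Definition kG_sub : kGmod k G.
Proof.
exists (sub_sort : lmodType k) sub_act.
- move=> g gG a x y; apply: val_inj.
  by rewrite sub_val_linear !val_sub_act // sub_val_linear kG_act_linear.
- by move=> x; apply: val_inj; rewrite val_sub_act // kG_act1.
- by move=> g h gG hG x; apply: val_inj; rewrite !val_sub_act ?groupM ?kG_actM.
Defined.

Definition sub_incl (x : kG_sub) : X := sub_val x.

Lemma hom_on_sub_incl : hom_on G sub_incl.
Proof. by split=> [|g gG x]; [exact: sub_val_linear|exact: val_sub_act]. Qed.

Lemma sub_incl_inj : injective sub_incl.
Proof. exact: val_inj. Qed.

Lemma sub_inclP x : sub_incl x \in S.
Proof. exact: sub_valP. Qed.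

Definition sub_lift (x : X) : kG_sub := insubd (0 : sub_sort) x.

Lemma sub_liftK x : x \in S -> sub_incl (sub_lift x) = x.
Proof. by move=> xS; rewrite /sub_incl [LHS](insubdK (0 : sub_sort)). Qed.

End Submodules.

Section Induction.
Import GRing.Theory.
Local Open Scope ring_scope.
Variables (k : fieldType) (gT : finGroupType).

Section Induced.
Variables (K G : {group gT}) (sKG : K \subset G) (V : kGmod k K).

Definition ind_ext (v : V) : kG_ind G V := ind_tens (1 : subg_of G)%g v.

Definition ind_ev_fun (x : subg_of G) (v : V) : V :=
  if sgval x \in K then kG_act (sgval x) v else 0.

Let ev_lin x : linear (ind_ev_fun x).
Proof.
rewrite /ind_ev_fun; case xK: (sgval x \in K); first exact: kG_act_linear.
exact: linear_zero.
Qed.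

Let ev_bal x h v : h \in K ->
  ind_ev_fun (x * subg G h)%g v = ind_ev_fun x (kG_act h v).
Proof.
move=> hK; have hG := fintype.subsetP sKG _ hK.
rewrite /ind_ev_fun /=. rewrite subgK // groupMr //.
by case: ifP => // xK; rewrite kG_actM.
Qed.

Definition ind_ev : kG_ind G V -> V := ind_lift ind_ev_fun.

Lemma ind_evE x v : ind_ev (ind_tens x v) = ind_ev_fun x v.
Proof. exact: ind_liftE. Qed.

Lemma act_ind g x v :
  kG_act g (ind_tens x v : kG_ind G V) = ind_tens (subg G g * x)%g v.
Proof. exact: ind_actE. Qed.

Lemma induced_by_ind : induced_by K G ind_ext ind_ev.
Proof.
have KG := fintype.subsetP sKG.
split.
- split=> [|g gK v]; first exact: ind_tens_linear.
  by rewrite act_ind mulg1 -[subg G g]mul1g ind_tens_balanced.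
- split=> [|g gK]; first exact: ind_lift_linear.
  have al := @kG_act_linear _ _ _ (kG_ind G V) _ (KG g gK).
  have el : linear ind_ev by exact: ind_lift_linear.
  apply: ind_eq => [||x v].
  + exact: linear_comp el al.
  + exact: linear_comp (kG_act_linear gK) el.
  rewrite act_ind !ind_evE /ind_ev_fun /= subgK ?KG // groupMl //.
  by case: ifP => xK; [rewrite kG_actM|rewrite lin0 //; exact: kG_act_linear].
by move=> g v gG; rewrite act_ind ind_evE /ind_ev_fun /= mulg1 subgK.
Qed.

(** The translate of 1 (x) V by the coset of x is the only one with a component
    at x (x) v. *)
Lemma tr_ind : rel_trace K G (ind_ext \o ind_ev) =1 id.
Proof.
have [[xl _] evK _] := induced_by_ind; have [el _] := evK.
have xe_hom : hom_on K (ind_ext \o ind_ev).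
  by apply: hom_on_comp evK; case: induced_by_ind.
have KG := fintype.subsetP sKG.
have [tl _] := hom_on_tr sKG (subxx G) (subxx G) xe_hom.
apply: ind_eq => // x v; rewrite /rel_trace (bigD1 (sgval x *: K)%g); last first.
  by apply/lcosetsP; exists (sgval x) => //; apply: subgP.
rewrite big1 ?addr0 => [|A /andP[AK nA]].
  rewrite (conj_map_repr sKG (subxx G) (subxx G) xe_hom) ?subgP //.
  rewrite /conj_map [(_ \o _) _]/comp act_ind ind_evE /ind_ev_fun /=.
  rewrite subgK ?groupV ?subgP // mulVg group1 kG_act1.
  by rewrite addr0 /ind_ext [LHS]act_ind mulg1 sgvalK.
have [rA defA] := repr_lcosets AK sKG.
rewrite /conj_map [(_ \o _) _]/comp act_ind ind_evE /ind_ev_fun /= subgK ?groupV //.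
rewrite ifN ?lin0 //; first exact: kG_act_linear.
apply: contra nA => xK; rewrite defA; apply/eqP/esym/lcoset_eqP.
by rewrite mem_lcoset.
Qed.

(** By tr_ind, the translates of a generating family of V generate Ind V. *)
Lemma findim_ind : kG_findim V -> kG_findim (kG_ind G V).
Proof.
move=> [n [/findim_finspan[s sV]]]; apply: finspan_axiom.
have [[xl _] _ _] := induced_by_ind.
exists [seq kG_act g (ind_ext v) | g <- enum G, v <- s] => u.
rewrite -[u]tr_ind /rel_trace; apply: rpred_sum => A /repr_lcosets[] // rA _.
rewrite /conj_map /=; set v := ind_ev _.
have al := @kG_act_linear _ _ _ (kG_ind G V) _ rA.
apply: (lspan_min (P := fun v => kG_act (repr A) (ind_ext v) \in lspan _)) (sV v).
- by rewrite lin0 // lin0 // rpred0.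
- move=> a x y Px Py; rewrite xl al; apply: rpredD => //; exact: rpredZ.
by move=> y ys; apply: mem_lspan; apply: allpairs_f => //; rewrite mem_enum.
Qed.

End Induced.

(** The projection formula: W (x) Ind V is induced from Res W (x) V, because T
    acts on the whole of W. *)
Lemma induced_by_tensor (B T : {group gT}) (sBT : B \subset T)
    (W : kGmod k T) (V : kGmod k B) (U : kGmod k T) (ext : V -> U) (ev : U -> V) :
  induced_by B T ext ev ->
  induced_by B T (@tmap k gT B T (kG_res sBT W) V W U id ext)
             (@tmap k gT T B W U (kG_res sBT W) V id ev).
Proof.
move=> [extB evB evE]; have [[xl _] [el _]] := (extB, evB).
have il : linear (id : W -> W) by [].
split; [by apply: hom_on_tmap|by apply: hom_on_tmap|move=> g v gT'].
have al := @kG_act_linear _ _ _ (kG_tensor W U) _ gT'.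
move: v; case gB: (g \in B).
  have alB := @kG_act_linear _ _ _ (kG_tensor (kG_res sBT W) V) _ gB.
  apply: tensor_eq => //.
    apply: linear_comp; first exact: tmap_linear.
    by apply: linear_comp => //; exact: tmap_linear.
  move=> x v; cbv beta; rewrite tmapE // act_tens // [RHS]act_tens // tmapE //.
  by rewrite evE // gB.
apply: tensor_eq; [|exact: linear_zero|].
  apply: linear_comp; first exact: tmap_linear.
  by apply: linear_comp => //; exact: tmap_linear.
move=> x v; cbv beta; rewrite tmapE // act_tens // tmapE // evE // gB.
by rewrite lin0 //; exact: tens_linear_r.
Qed.

Lemma induced_by_dsum (B T : {group gT}) (I : Type) (V : I -> kGmod k B)
    (U : I -> kGmod k T) (ext : forall i, V i -> U i) (ev : forall i, U i -> V i)
    (xl : forall i, linear (ext i)) (el : forall i, linear (ev i)) :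
  B \subset T -> (forall i, induced_by B T (ext i) (ev i)) ->
  induced_by B T (dsum_map xl) (dsum_map el).
Proof.
move=> sBT ind; split.
- by apply: hom_on_dsum_map => // i; case: (ind i).
- by apply: hom_on_dsum_map => // i; case: (ind i).
move=> g v gT'; apply: dsum_eq => i; have [_ _ evE] := ind i.
have gE : (kG_act g (dsum_map xl v) : kG_dsum U) i = kG_act g (ext i (v i)).
  exact: dsum_actE.
rewrite -[LHS]/(ev i ((kG_act g (dsum_map xl v) : kG_dsum U) i)) gE evE //.
by case: ifP => gB //; rewrite [RHS]dsum_actE.
Qed.

Lemma findim_tensor (G : {group gT}) (X Y : kGmod k G) :
  kG_findim X -> kG_findim Y -> kG_findim (kG_tensor X Y).
Proof.
move=> [n [/findim_frame[e [c [cl eX]]]]] [m [/findim_finspan[s sY]]].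
apply: finspan_axiom.
exists [seq tens (e j) y | j <- enum 'I_n, y <- s] => t.
rewrite [t](tcoord_sum cl eX); apply: rpred_sum => j _.
have tl := @tens_linear_r _ _ _ X Y (e j).
apply: (lspan_min (P := fun y => tens (e j) y \in lspan _)) (sY (tcoord c j t)).
- by rewrite lin0 // rpred0.
- by move=> a u v Pu Pv; rewrite tl; apply: rpredD => //; apply: rpredZ.
by move=> y ys; apply: mem_lspan; apply: allpairs_f => //; rewrite mem_enum.
Qed.

End Induction.

(** * Pure projective maps and the ideal of negligible maps *)

Section Ideals.
Import GRing.Theory.
Local Open Scope ring_scope.
Variables (k : fieldType) (gT : finGroupType).

Lemma direct_summand_retract (G : {group gT}) (X Y : kGmod k G) :
  direct_summand X Y -> exists (i : X -> Y) (r : Y -> X),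
    [/\ hom_on G i, hom_on G r & cancel i r].
Proof.
move=> [Z [f [f' fK f'K]]]; have [fl fG] := kG_homP f.
have f'l : linear f' by move=> a u v; apply: (can_inj fK); rewrite fl !f'K.
have f'G g : g \in G -> forall z, f' (kG_act g z) = kG_act g (f' z).
  by move=> gG z; apply: (can_inj fK); rewrite fG // !f'K.
exists (fun x => f' (x, 0)), (fun y => (f y).1); split.
- split=> [a u v|g gG x].
    by rewrite -f'l; congr f'; congr pair; rewrite -[RHS]/(a *: (0 : Z) + 0) scaler0 addr0.
  rewrite -f'G //; congr f'; congr pair; exact/esym/(lin0 (kG_act_linear gG)).
- by split=> [a u v|g gG x]; rewrite ?fl ?fG.
by move=> x; rewrite f'K.
Qed.

(** The complement is the kernel of the retraction. *)
Lemma retract_direct_summand (G : {group gT}) (X Y : kGmod k G)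
    (i : X -> Y) (r : Y -> X) :
  hom_on G i -> hom_on G r -> cancel i r -> direct_summand X Y.
Proof.
move=> [il iG] [rl rG] iK.
pose S : {pred Y} := fun y => r y == 0.
have S_sub : submod_closed S.
  split; first by rewrite unfold_in lin0.
  by move=> a u v /eqP u0 /eqP v0; rewrite unfold_in rl u0 v0 scaler0 addr0.
have S_act g y : g \in G -> y \in S -> kG_act g y \in S.
  move=> gG /eqP y0; by rewrite unfold_in rG // y0 (lin0 (kG_act_linear gG)).
pose Z := kG_sub S_sub S_act; exists Z.
have inS y : y - i (r y) \in S by rewrite unfold_in (linB rl) iK subrr.
have jl := proj1 (hom_on_sub_incl S_sub S_act).
have jG := proj2 (hom_on_sub_incl S_sub S_act).
pose f (y : Y) : kG_sum2 X Z := (r y, sub_lift S_sub S_act (y - i (r y))).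
have fP : is_kG_hom f.
  split=> [a u v|g gG y]; congr pair; rewrite ?rl ?rG //; apply: (@sub_incl_inj _ _ _ _ _ S_sub S_act).
    by rewrite jl !sub_liftK // -?rl // rl il opprD addrACA scalerBr.
  by rewrite jG // !sub_liftK // -?rG // rG // iG // (linB (kG_act_linear gG)).
exists (mk_kG_hom fP).
exists (fun z : kG_sum2 X Z => i z.1 + sub_incl z.2) => [y|[x z]] /=.
  by rewrite sub_liftK // addrC subrK.
have rz : r (sub_incl z) = 0 by apply/eqP; apply: (sub_inclP z).
rewrite /f; congr pair; first by rewrite (linD rl) iK rz addr0.
apply: (@sub_incl_inj _ _ _ _ _ S_sub S_act); rewrite sub_liftK //.
by rewrite (linD rl) iK rz addr0 addrC addKr.
Qed.

Section PureProjectiveMaps.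
Variables (GX GY GZ : {group gT}).
Variables (X : kGmod k GX) (Y : kGmod k GY) (Z : kGmod k GZ).

Definition pp_map (T : {group gT}) (f : X -> Y) :=
  exists (I : Type) (F : I -> kGmod k T) (a : X -> kG_dsum F) (b : kG_dsum F -> Y),
    [/\ forall i, kG_findim (F i), hom_on T a, hom_on T b & f = b \o a].

End PureProjectiveMaps.

Section PureProjectiveTheory.
Variables (GX GY GZ : {group gT}).
Variables (X : kGmod k GX) (Y : kGmod k GY) (Z : kGmod k GZ).
Implicit Types B T : {group gT}.

Lemma pp_map_compl T (h : Y -> Z) (f : X -> Y) :
  hom_on T h -> pp_map T f -> pp_map T (h \o f).
Proof.
move=> hT [I [F [a [b [fdF aT bT ->]]]]].
by exists I, F, a, (h \o b); split=> //; apply: hom_on_comp.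
Qed.

Lemma pp_map_compr T (f : Y -> Z) (h : X -> Y) :
  hom_on T h -> pp_map T f -> pp_map T (f \o h).
Proof.
move=> hT [I [F [a [b [fdF aT bT ->]]]]].
by exists I, F, (a \o h), b; split=> //; apply: hom_on_comp.
Qed.

Lemma pp_map0 T : T \subset GY -> pp_map T (fun _ : X => 0 : Y).
Proof.
move=> sTY; exists void, (fun=> kG_zero k T), (fun=> 0), (fun=> 0).
by split=> //; apply: hom_on_zero.
Qed.

Lemma pp_map_add T (f h : X -> Y) : T \subset GY ->
  pp_map T f -> pp_map T h -> pp_map T (f \+ h).
Proof.
move=> sTY [I [F [a [b [fdF [al aT] bT ->]]]]].
move=> [I' [F' [a' [b' [fdF' [a'l a'T] b'T ->]]]]].
pose FF (i : I + I') := match i with inl j => F j | inr j => F' j end.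
pose j0 x : Defs.dprod FF := fun i =>
  match i as i' return FF i' with inl j => a x j | inr j => a' x j end.
have j0P x : j0 x \in @fin_supp _ _ _ _ FF.
  have /asboolP fa := dsum_valP (a x); have /asboolP fa' := dsum_valP (a' x).
  apply/asboolP; apply: (@sub_finite_set _ _
    (inl @` [set i | dsum_val (a x) i != 0] `|`
     inr @` [set i | dsum_val (a' x) i != 0])%classic).
    by case=> i nz; [left|right]; exists i.
  by rewrite finite_setU; split; apply: finite_image.
have p0P (d : kG_dsum FF) : ((fun i => d (inl i)) : Defs.dprod F) \in @fin_supp _ _ _ _ F.
  have /asboolP fd := dsum_valP d; apply/asboolP.
  apply: (finite_preimage (f := inl) _ fd).
  by move=> x y _ _ [].
have p1P (d : kG_dsum FF) : ((fun i => d (inr i)) : Defs.dprod F') \in @fin_supp _ _ _ _ F'.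
  have /asboolP fd := dsum_valP d; apply/asboolP.
  apply: (finite_preimage (f := inr) _ fd).
  by move=> x y _ _ [].
pose p0 (d : kG_dsum FF) : kG_dsum F := DSum (p0P d).
pose p1 (d : kG_dsum FF) : kG_dsum F' := DSum (p1P d).
pose jj (x : X) : kG_dsum FF := DSum (j0P x).
have pT : hom_on T p0.
  split=> [c u v|g gT' d]; apply: dsum_eq => i //.
  by rewrite [RHS]dsum_actE //; apply: (dsum_actE d (inl i)).
have p'T : hom_on T p1.
  split=> [c u v|g gT' d]; apply: dsum_eq => i //.
  by rewrite [RHS]dsum_actE //; apply: (dsum_actE d (inr i)).
exists (I + I')%type, FF, jj.
exists ((b \o p0) \+ (b' \o p1)).
split; first by case.
- split=> [c u v|g gT' x]; apply: dsum_eq => -[i|i] /=.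
  + by rewrite -[LHS]/(a (c *: u + v) i) al.
  + by rewrite -[LHS]/(a' (c *: u + v) i) a'l.
  + by rewrite dsum_actE // -[LHS]/(a (kG_act g x) i) aT // [LHS]dsum_actE.
  by rewrite dsum_actE // -[LHS]/(a' (kG_act g x) i) a'T // [LHS]dsum_actE.
- by apply: hom_on_add => //; apply: hom_on_comp.
apply/funext => x /=; congr (b _ + b' _); exact: dsum_eq.
Qed.

Lemma pp_map_res B T (f : X -> Y) : B \subset T -> pp_map T f -> pp_map B f.
Proof.
move=> sBT [I [F [a [b [fdF aT bT ->]]]]].
pose F' i := kG_res sBT (F i).
have l1 i : linear (id : F i -> F' i) by [].
have l2 i : linear (id : F' i -> F i) by [].
exists I, F', (dsum_map l1 \o a), (b \o dsum_map l2); split=> //.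
- apply: hom_on_comp; last exact: hom_on_sub aT.
  by apply: hom_on_dsum_map.
- apply: hom_on_comp; first exact: hom_on_sub bT.
  by apply: hom_on_dsum_map.
by apply/funext => x /=; congr b; apply: dsum_eq.
Qed.

(** The induced modules of the finite dimensional modules F_i form again a
    family of finite dimensional modules, and their sum is induced from the sum
    of the F_i. *)
Lemma pp_map_tr B T (f : X -> Y) : B \subset T -> T \subset GX -> T \subset GY ->
  pp_map B f -> pp_map T (rel_trace B T f).
Proof.
move=> sBT sTX sTY [I [F [a [b [fdF aB bB ->]]]]].
pose U i := kG_ind T (F i).
have ind i : induced_by B T (@ind_ext _ _ B T (F i)) (@ind_ev _ _ B T (F i)).
  exact: induced_by_ind.
have xl i : linear (@ind_ext _ _ B T (F i)) by case: (ind i) => -[].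
have el i : linear (@ind_ev _ _ B T (F i)) by case: (ind i) => _ [].
have indD := induced_by_dsum xl el sBT ind; have [xB eB _] := indD.
exists I, U, (rel_trace B T (dsum_map xl \o a)), (rel_trace B T (b \o dsum_map el)); split.
- by move=> i; apply: findim_ind.
- by apply: hom_on_tr => //; apply: hom_on_comp.
- by apply: hom_on_tr => //; apply: hom_on_comp.
by apply/funext => x; apply: tr_induced indD _ x => //; case: bB.
Qed.

End PureProjectiveTheory.

(** The identity of X is negligible if and only if X is a summand of the sum of
    a pure projective module and of modules induced from proper subgroups. *)
Inductive negligible (GX GY : {group gT}) (X : kGmod k GX) (Y : kGmod k GY)
    (T : {group gT}) : (X -> Y) -> Prop :=
| negligible_pp f : pp_map T f -> negligible T f
| negligible_tr (B : {group gT}) th : B \proper T -> hom_on B th ->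
    negligible T (rel_trace B T th)
| negligible_add f h : negligible T f -> negligible T h -> negligible T (f \+ h).

Section IdealTheory.
Variables (GX GY GZ : {group gT}).
Variables (X : kGmod k GX) (Y : kGmod k GY) (Z : kGmod k GZ).
Implicit Types B T : {group gT}.

Lemma negligible_compl T (h : Y -> Z) (f : X -> Y) :
  hom_on T h -> negligible T f -> negligible T (h \o f).
Proof.
move=> hT; elim=> {f} [f ppf|B th sBT thB|f1 f2 _ J1 _ J2].
- exact/negligible_pp/pp_map_compl.
- have sB := proper_sub sBT.
  rewrite -(funext (tr_compl sB th hT)); apply: negligible_tr => //.
  by apply: hom_on_comp => //; apply: hom_on_sub hT.
rewrite (_ : h \o _ = (h \o f1) \+ (h \o f2)); first exact: negligible_add.
by apply/funext => x /=; have [hl _] := hT; rewrite linD.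
Qed.

Lemma negligible_compr T (f : Y -> Z) (h : X -> Y) :
  hom_on T h -> negligible T f -> negligible T (f \o h).
Proof.
move=> hT; elim=> {f} [f ppf|B th sBT thB|f1 f2 _ J1 _ J2].
- exact/negligible_pp/pp_map_compr.
- have sB := proper_sub sBT.
  rewrite -(funext (tr_compr sB th hT)); apply: negligible_tr => //.
  by apply: hom_on_comp => //; apply: hom_on_sub hT.
exact: negligible_add J1 J2.
Qed.

End IdealTheory.
End Ideals.

(** * Sensitive subgroups *)

Section Sensitive.
Import GRing.Theory.
Local Open Scope ring_scope.
Variables (k : fieldType) (gT : finGroupType).
Variables (G : {group gT}) (w : kGmod k G).

(** If w (x) M is not pure projective for some M, the same is true for some M
    over every larger subgroup of G. Discarding what comes from proper subgroups
    confines sensitivity to subgroups of the conjugates of any Q for which w is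
    Q-projective, by sensitive_sub. *)
Definition sensitive (T : {group gT}) :=
  exists (sTG : T \subset G) (M : kGmod k T),
    ~ negligible T (id : kG_tensor (kG_res sTG w) M -> kG_tensor (kG_res sTG w) M).

(** By induction on the order of T: the identity of w (x) M is a sum of a pure
    projective map and of traces of maps that are pure projective over proper
    subgroups, and a trace of a pure projective map is pure projective. *)
Lemma insensitive_pp (T : {group gT}) (sTG : T \subset G) (M : kGmod k T) :
  (forall B : {group gT}, ~ sensitive B) ->
  pp_map T (id : kG_tensor (kG_res sTG w) M -> kG_tensor (kG_res sTG w) M).
Proof.
move=> noS.
have [n] := ubnP #|T|; elim: n T sTG M => // n IH T sTG M; rewrite ltnS => leTn.
set N := kG_tensor (kG_res sTG w) M.
have : negligible T (id : N -> N).
  by apply: contrapT => nJ; apply: (noS T); exists sTG, M.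
elim=> [f //|B th pBT thB|f h _ ppf _ pph]; last exact: pp_map_add.
have [sBT ltBT] := andP pBT; have ltBT' := proper_card pBT.
apply: pp_map_tr => //.
have sBG : B \subset G := subset_trans sBT sTG.
(* r and r' identify the restriction of N to B with a module w (x) M' over B. *)
pose NB := kG_tensor (kG_res sBG w) (kG_res sBT M).
pose r : N -> NB := @tmap k gT T B (kG_res sTG w) M (kG_res sBG w) (kG_res sBT M) id id.
pose r' : NB -> N := @tmap k gT B T (kG_res sBG w) (kG_res sBT M) (kG_res sTG w) M id id.
have rB : hom_on B r by apply: hom_on_tmap.
have r'B : hom_on B r' by apply: hom_on_tmap.
have rK : r' \o r =1 id.
  by move=> x; rewrite /r /r' tmap_comp //; apply: tmap_id.
rewrite (_ : th = (th \o r') \o id \o r); last first.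
  by apply/funext => x; rewrite /= -[in LHS](rK x).
apply: pp_map_compr => //; apply: pp_map_compl; first exact: hom_on_comp.
by apply: IH; apply: leq_trans ltBT' leTn.
Qed.

Lemma pp_pure_projective (T : {group gT}) (sTG : T \subset G) (M : kGmod k T) :
  pp_map T (id : kG_tensor (kG_res sTG w) M -> kG_tensor (kG_res sTG w) M) ->
  pure_projective (kG_tensor M (kG_res sTG w)).
Proof.
set N := kG_tensor _ M => -[I [F [a [b [fdF aT bT abE]]]]].
exists I, F; split=> //.
pose W := kG_res sTG w.
pose s1 : kG_tensor M W -> N := tensor_lift (fun x y => tens y x).
pose s2 : N -> kG_tensor M W := tensor_lift (fun x y => tens y x).
have s1E x y : s1 (tens x y) = tens y x.
  apply: (tensor_liftE (b := fun x y => tens y x)) => u.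
    exact: tens_linear_r.
  exact: tens_linear_l.
have s2E x y : s2 (tens x y) = tens y x.
  apply: (tensor_liftE (b := fun x y => tens y x)) => u.
    exact: tens_linear_r.
  exact: tens_linear_l.
have s1l : linear s1.
  by apply: tensor_lift_linear => u; [exact: tens_linear_r|exact: tens_linear_l].
have s2l : linear s2.
  by apply: tensor_lift_linear => u; [exact: tens_linear_r|exact: tens_linear_l].
have s1T : hom_on T s1.
  split=> // g gT'.
  have al1 := @kG_act_linear _ _ _ (kG_tensor M W) _ gT'.
  have al2 := @kG_act_linear _ _ _ N _ gT'.
  apply: tensor_eq (linear_comp s1l al1) (linear_comp al2 s1l) _ => x y.
  rewrite -[LHS]/(s1 (kG_act g (tens x y : kG_tensor M W))) act_tens // s1E.
  by rewrite -[RHS]/(kG_act g (s1 (tens x y))) s1E act_tens.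
have s2T : hom_on T s2.
  split=> // g gT'.
  have al1 := @kG_act_linear _ _ _ (kG_tensor M W) _ gT'.
  have al2 := @kG_act_linear _ _ _ N _ gT'.
  apply: tensor_eq (linear_comp s2l al2) (linear_comp al1 s2l) _ => x y.
  rewrite -[LHS]/(s2 (kG_act g (tens x y : N))) act_tens // s2E.
  by rewrite -[RHS]/(kG_act g (s2 (tens x y))) s2E act_tens.
apply: (@retract_direct_summand _ _ _ _ _ (a \o s1) (s2 \o b)).
- exact: hom_on_comp.
- exact: hom_on_comp.
move=> x; have abK y : b (a y) = y by rewrite -[RHS]/(id y) abE.
rewrite /= abK; move: x; apply: (tensor_eq (f := s2 \o s1) (h := id)) => //.
  exact: linear_comp.
by move=> x y; rewrite /= s1E s2E.
Qed.

(** One half of Higman's criterion. *)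
Lemma rel_projective_trace (Q : {group gT}) : Q \subset G ->
  rel_projective Q w -> exists2 th : w -> w, hom_on Q th & rel_trace Q G th = id.
Proof.
move=> sQG [V /direct_summand_retract[i [r [iG rG iK]]]].
have [xQ eQ _] := induced_by_ind sQG V.
pose th0 := @ind_ext _ _ Q G V \o @ind_ev _ _ Q G V.
have th0Q : hom_on Q th0 by apply: hom_on_comp.
exists (r \o th0 \o i).
  apply: hom_on_comp; last exact: hom_on_sub iG.
  by apply: hom_on_comp => //; apply: hom_on_sub rG.
apply/funext => x; rewrite (tr_compr sQG _ iG) /= (tr_compl sQG _ rG) /=.
by rewrite tr_ind // iK.
Qed.

Lemma tmap_tr (T D : {group gT}) (sTG : T \subset G) (M : kGmod k T)
    (th : w -> w) :
  D \subset T -> linear th -> linear (rel_trace D T th) ->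
  tmap (rel_trace D T th : kG_res sTG w -> kG_res sTG w) (id : M -> M) =1
  rel_trace D T (tmap (th : kG_res sTG w -> kG_res sTG w) (id : M -> M)).
Proof.
move=> sDT thl trl.
have til := @tmap_linear _ _ _ _ (kG_res sTG w) M (kG_res sTG w) M th id thl
  (fun _ _ _ => erefl).
have TG := fintype.subsetP sTG.
apply: tensor_eq => [||x y].
- exact: tmap_linear.
- apply: linear_bigsum => A /repr_lcosets[] // rT _.
  exact: (linear_conj_map rT rT til).
rewrite tmapE // /rel_trace (lin_sum (@tens_linear_l _ _ _ (kG_res sTG w) M y)).
apply: eq_bigr => A /repr_lcosets[] // rT _.
rewrite /conj_map act_tens ?groupV // tmapE // act_tens // actVK //.
Qed.

(** The identity of w is a trace from Q. Restricted to T it is a sum of traces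
    from the groups T n gQg^-1, which would all be proper subgroups of T. *)
Lemma sensitive_sub (Q T : {group gT}) : Q \subset G -> rel_projective Q w ->
  sensitive T -> exists2 g, g \in G & T \subset (Q :^ g)%g.
Proof.
move=> sQG /(rel_projective_trace sQG)[th thQ trE] [sTG [M nJ]].
apply: contrapT => nsub; apply: nJ; set N := kG_tensor _ M.
pose P (f : w -> w) := linear f /\
  negligible T (tmap (f : kG_res sTG w -> kG_res sTG w) (id : M -> M)).
have idl : linear (id : M -> M) by [].
suff: P (rel_trace Q G th).
  rewrite trE => -[_]; congr (negligible _ _); apply/funext; exact: tmap_id.
apply: (mackey sTG sQG (subxx G) (subxx G) thQ).
- split; first exact: linear_zero.
  rewrite (_ : tmap _ _ = fun=> 0); first by apply/negligible_pp/pp_map0.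
  apply/funext; apply: tensor_eq => [||x y].
  + by apply: tmap_linear => //; exact: linear_zero.
  + exact: linear_zero.
  rewrite tmapE //; last exact: linear_zero.
  exact: (lin0 (@tens_linear_l _ _ _ (kG_res sTG w) M y)).
- move=> f h [fl Jf] [hl Jh]; split; first exact: linear_add.
  rewrite (_ : tmap _ _ = tmap (f : kG_res sTG w -> kG_res sTG w) (id : M -> M) \+
     tmap (h : kG_res sTG w -> kG_res sTG w) (id : M -> M)); first exact: negligible_add.
  apply/funext; apply: tensor_eq => [||x y].
  + by apply: tmap_linear => //; exact: linear_add.
  + by apply: linear_add; apply: tmap_linear.
  rewrite /= !tmapE //; last exact: linear_add.
  exact: (linD (@tens_linear_l _ _ _ (kG_res sTG w) M y)).
move=> g gG; set D := (T :&: Q :^ g^-1)%G.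
have sDT : D \subset T by apply: subsetIl.
have thD : hom_on D (conj_map g th).
  by apply: hom_on_sub (subsetIr _ _) _; apply: hom_on_conj_map.
have [trl _] := hom_on_tr sDT sTG sTG thD.
split=> //; rewrite (funext (tmap_tr (sTG := sTG) (M := M) sDT (proj1 thD) trl)).
apply: (@negligible_tr _ _ _ _ _ _ _ D); last first.
  by apply: hom_on_tmap.
rewrite properE sDT /=; apply/negP => sTD; apply: nsub.
exists g^-1%g; first by rewrite groupV.
exact: subset_trans sTD (subsetIr _ _).
Qed.

End Sensitive.

(** * The total object of a sequence ker phi -> F -> N *)

Section AcyclicTotal.
Import GRing.Theory.
Local Open Scope ring_scope.
Variables (k : fieldType) (gT : finGroupType).
Variables (H T Z : {group gT}) (defH : (T \x Z = H)%g).
Variables (F N : kGmod k T) (phi : F -> N) (phiT : hom_on T phi).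

Let Zs := subg_of Z.

Let sTH : T \subset H. Proof. by have [_ <- _ _] := dprodP defH; apply: mulG_subl. Qed.
Let sZH : Z \subset H. Proof. by have [_ <- _ _] := dprodP defH; apply: mulG_subr. Qed.
Let TH := fintype.subsetP sTH.
Let ZH := fintype.subsetP sZH.

Let pt (h : gT) := divgr T Z h.
Let pz (h : gT) := remgr T Z h.

Let pt_in h : h \in H -> pt h \in T.
Proof. by have [_ <- _ _] := dprodP defH; apply: mem_divgr. Qed.

Let pz_in h : h \in H -> pz h \in Z.
Proof. by have [_ <- _ _] := dprodP defH; apply: mem_remgr. Qed.

Let compl : Z \in [complements to T in H]%g.
Proof. by have [_ defH' _ tiTZ] := dprodP defH; apply/complP. Qed.

Let ptM : {in H &, {morph pt : x y / (x * y)%g}}.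
Proof. by have [_ _ cTZ _] := dprodP defH; apply: (divgrM compl). Qed.

Let pzM : {in H &, {morph pz : x y / (x * y)%g}}.
Proof. by apply: (remgrM compl); have [] := dprod_normal2 defH. Qed.

Let pt_T t : t \in T -> pt t = t.
Proof. exact: divgr_id. Qed.

Let pz_T t : t \in T -> pz t = 1%g.
Proof. exact: remgr1. Qed.

Let pz_Z z : z \in Z -> pz z = z.
Proof. by have [_ _ _ tiTZ] := dprodP defH; apply: remgr_id. Qed.

Let pt_Z z : z \in Z -> pt z = 1%g.
Proof.
move=> zZ; have e : z = (pt z * pz z)%g by apply: divgr_eq.
by apply: (mulIg z); rewrite mul1g -{2}(pz_Z zZ) -e.
Qed.

(** With this action, the functions from Z to U form the module coinduced from
    U. *)
Definition shift_act (U : kGmod k T) h (b : Zs -> U) : Zs -> U :=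
  fun c => kG_act (pt h) (b ((subg Z (pz h))^-1 * c)%g).

Lemma shift_act_linear (U : kGmod k T) h : h \in H -> linear (@shift_act U h).
Proof.
move=> hH a u v; apply/funext => c.
exact: kG_act_linear (pt_in hH) a (u _) (v _).
Qed.

Lemma shift_act1 (U : kGmod k T) b : @shift_act U 1%g b = b.
Proof.
apply/funext => c; rewrite /shift_act pt_T // pz_T // kG_act1.
by rewrite (_ : subg Z 1 = 1%g) ?morph1 // invg1 mul1g.
Qed.

Lemma shift_actM (U : kGmod k T) g h b : g \in H -> h \in H ->
  @shift_act U (g * h)%g b = shift_act g (shift_act h b).
Proof.
move=> gH hH; apply/funext => c; rewrite /shift_act ptM // pzM //.
rewrite kG_actM ?pt_in //; congr (kG_act _ (kG_act _ (b _))).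
by rewrite subgM ?pz_in // invMg mulgA.
Qed.

Definition shift_mod : kGmod k H.
Proof.
exists (((Zs -> F) * (Zs -> N))%type : lmodType k)
  (fun h x => (shift_act h x.1, shift_act h x.2)).
- by move=> h hH a [b c] [b' c']; congr pair; apply: shift_act_linear.
- by case=> b c; rewrite /= !shift_act1.
- by move=> g h gH hH [b c]; rewrite /= !shift_actM.
Defined.

Definition total_pred : {pred shift_mod} := fun x : shift_mod =>
  `[< forall c : Zs, phi (x.1 c) = \sum_d x.2 d >].

Lemma total_pred_sub : submod_closed total_pred.
Proof.
have [phil _] := phiT; split=> [|a x y /asboolP xP /asboolP yP].
  by apply/asboolP => c; rewrite /= (lin0 phil) big1.
apply/asboolP => c.
rewrite -[LHS]/(phi (a *: x.1 c + y.1 c)) phil xP yP scaler_sumr -big_split.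
by [].
Qed.

Lemma total_pred_act g x : g \in H -> x \in total_pred ->
  kG_act g x \in total_pred.
Proof.
move=> gH /asboolP xP; apply/asboolP => c; have ptT := pt_in gH.
have [_ phiE] := phiT.
rewrite -[LHS]/(phi (kG_act (pt g) (x.1 ((subg Z (pz g))^-1 * c)%g))).
rewrite phiE // xP act_sum // [RHS](reindex_inj (mulgI (subg Z (pz g)))) /=.
by apply: eq_bigr => d _; rewrite /shift_act mulKg.
Qed.

(** Modulo modules induced from T, this is the total object of the complex
    ker phi -> F -> N with trivial action of Z. If phi is onto, k has
    characteristic p, and Z is cyclic of order p with generator 1 + t, then t
    makes it a string that passes p - 1 times through ker phi, once through F
    and p - 1 times through N. *)
Definition total : kGmod k H := kG_sub total_pred_sub total_pred_act.

Definition tot1 (x : total) (c : Zs) : F := (sub_incl x).1 c.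
Definition tot2 (x : total) (c : Zs) : N := (sub_incl x).2 c.

Lemma tot_eq x y : (forall c, tot1 x c = tot1 y c) ->
  (forall c, tot2 x c = tot2 y c) -> x = y.
Proof.
move=> e1 e2; apply: (@sub_incl_inj _ _ _ _ _ total_pred_sub total_pred_act).
by rewrite [LHS]surjective_pairing [RHS]surjective_pairing;
   congr pair; apply/funext.
Qed.

Lemma totP (x : total) c : phi (tot1 x c) = \sum_d tot2 x d.
Proof. by have /asboolP xP := sub_inclP x; apply: xP. Qed.

Lemma tot1_linear c : linear (tot1^~ c). Proof. by []. Qed.
Lemma tot2_linear c : linear (tot2^~ c). Proof. by []. Qed.

Lemma sub_incl_act h (x : total) : h \in H ->
  sub_incl (kG_act h x) = kG_act h (sub_incl x).
Proof.
move=> hH; have [_ e] := hom_on_sub_incl total_pred_sub total_pred_act; exact: e.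
Qed.

Lemma tot1_actZ (x : total) z c : z \in Z ->
  tot1 (kG_act z x) c = tot1 x ((subg Z z)^-1 * c)%g.
Proof.
move=> zZ; rewrite /tot1 sub_incl_act ?ZH //.
by rewrite -[LHS]/(shift_act z (sub_incl x).1 c) /shift_act pt_Z // pz_Z // kG_act1.
Qed.

Lemma tot2_actZ (x : total) z c : z \in Z ->
  tot2 (kG_act z x) c = tot2 x ((subg Z z)^-1 * c)%g.
Proof.
move=> zZ; rewrite /tot2 sub_incl_act ?ZH //.
by rewrite -[LHS]/(shift_act z (sub_incl x).2 c) /shift_act pt_Z // pz_Z // kG_act1.
Qed.

Lemma subg1 : subg Z 1 = 1%g. Proof. exact: morph1. Qed.

Lemma tot1_actT (x : total) t c : t \in T ->
  tot1 (kG_act t x) c = kG_act t (tot1 x c).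
Proof.
move=> tT; rewrite /tot1 sub_incl_act ?TH //.
by rewrite -[LHS]/(shift_act t (sub_incl x).1 c) /shift_act pt_T // pz_T // subg1 invg1 mul1g.
Qed.

Lemma tot2_actT (x : total) t c : t \in T ->
  tot2 (kG_act t x) c = kG_act t (tot2 x c).
Proof.
move=> tT; rewrite /tot2 sub_incl_act ?TH //.
by rewrite -[LHS]/(shift_act t (sub_incl x).2 c) /shift_act pt_T // pz_T // subg1 invg1 mul1g.
Qed.

Lemma hom_on_tot1 c : hom_on T (tot1^~ c).
Proof. by split=> [|t tT x]; [exact: tot1_linear|exact: tot1_actT]. Qed.

Lemma hom_on_tot2 c : hom_on T (tot2^~ c).
Proof. by split=> [|t tT x]; [exact: tot2_linear|exact: tot2_actT]. Qed.

Definition mk_tot (b : Zs -> F) (a : Zs -> N) : total :=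
  sub_lift total_pred_sub total_pred_act (b, a).

Section MakeTotal.
Variables (b : Zs -> F) (a : Zs -> N).
Hypothesis ba : forall c, phi (b c) = \sum_d a d.

Let baP : ((b, a) : shift_mod) \in total_pred. Proof. exact/asboolP. Qed.

Lemma tot1_mk c : tot1 (mk_tot b a) c = b c.
Proof. by rewrite /tot1 sub_liftK. Qed.

Lemma tot2_mk c : tot2 (mk_tot b a) c = a c.
Proof. by rewrite /tot2 sub_liftK. Qed.

End MakeTotal.

Lemma hom_on_tot (U : kGmod k T) (s : U -> total) :
  (forall c, hom_on T (fun u => tot1 (s u) c)) ->
  (forall c, hom_on T (fun u => tot2 (s u) c)) -> hom_on T s.
Proof.
move=> s1 s2; split=> [a u v|t tT u]; apply: tot_eq => c.
- by have [->] := s1 c; rewrite tot1_linear.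
- by have [->] := s2 c; rewrite tot2_linear.
- by have [_ ->] := s1 c; rewrite // tot1_actT.
by have [_ ->] := s2 c; rewrite // tot2_actT.
Qed.

Lemma tr_dprod (GX GY : {group gT}) (X : kGmod k GX) (Y : kGmod k GY)
    (th : X -> Y) : H \subset GX -> H \subset GY -> hom_on T th ->
  forall x, rel_trace T H th x = \sum_(c : Zs) conj_map (sgval c) th x.
Proof.
move=> sHX sHY thT x.
have [_ defTZ cTZ tiTZ] := dprodP defH.
have -> : \sum_(c : Zs) conj_map (sgval c) th x = \sum_(z in Z) conj_map z th x.
  rewrite [RHS](reindex (fun c : Zs => sgval c)) /=.
    by apply: eq_bigl => c; rewrite subgP.
  by exists (subg Z) => z zZ; [rewrite sgvalK|rewrite subgK].
rewrite /rel_trace (_ : lcosets T H = [set (z *: T)%g | z in Z]); last first.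
  apply/setP => A; apply/lcosetsP/imsetP => -[].
    move=> h; rewrite -defTZ -(centC cTZ) => /mulsgP[z t zZ tT ->] ->.
    by exists z; rewrite // lcosetM lcoset_id.
  by move=> z zZ ->; exists z; rewrite ?ZH.
rewrite big_imset /=.
  by apply: eq_bigr => z zZ; rewrite (conj_map_repr sTH sHX sHY thT) ?ZH.
move=> z z' zZ z'Z /(congr1 (fun U : {set gT} => z \in U)).
rewrite lcoset_refl mem_lcoset => /esym zT.
have : (z'^-1 * z)%g \in T :&: Z by rewrite inE zT groupM ?groupV.
by rewrite tiTZ => /set1P/(canRL (mulKg _)); rewrite invgK mulg1.
Qed.

Let one : Zs := 1%g.

Lemma tot1_act_sgval (x : total) (d c : Zs) :
  tot1 (kG_act (sgval d) x) c = tot1 x (d^-1 * c)%g.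
Proof. by rewrite tot1_actZ ?subgP // sgvalK. Qed.

Lemma tot2_act_sgval (x : total) (d c : Zs) :
  tot2 (kG_act (sgval d) x) c = tot2 x (d^-1 * c)%g.
Proof. by rewrite tot2_actZ ?subgP // sgvalK. Qed.

Section Sections.
Variables (K : kGmod k T) (io : K -> F).
Hypotheses (ioT : hom_on T io) (phi_io : forall u, phi (io u) = 0).

Let delta (U : kGmod k T) (x : U) (c : Zs) : U := if c == one then x else 0.

Let sum_delta (U : kGmod k T) (x : U) : \sum_c delta x c = x.
Proof. by rewrite /delta -big_mkcond big_pred1_eq. Qed.

Let delta_hom (U V : kGmod k T) (h : U -> V) c :
  hom_on T h -> hom_on T (fun x => delta (h x) c).
Proof.
rewrite /delta; case: (c == one) => hT; first exact: hT.
exact: hom_on_zero.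
Qed.

(** Every map over H from a finite dimensional module to the total object, when
    maps to N lift through phi, is the sum of two traces from T, of a map
    through const_sec that accounts for the N-components and of a map through
    kernel_sec for what is left. *)
Definition const_sec (x : F) : total := mk_tot (fun=> x) (delta (phi x)).
Definition kernel_sec (u : K) : total := mk_tot (delta (io u)) (fun=> 0).

Let sec1P x (c : Zs) : phi ((fun=> x) c) = \sum_d delta (phi x) d.
Proof. by rewrite sum_delta. Qed.

Let sec2P u (c : Zs) : phi (delta (io u) c) = \sum_(d : Zs) (fun=> 0) d.
Proof.
rewrite big1 // /delta; case: (c == one); first exact: phi_io.
exact: (lin0 (proj1 phiT)).
Qed.

Let tot1_sec1 x c : tot1 (const_sec x) c = x.
Proof. exact: (tot1_mk (sec1P x)). Qed.
Let tot2_sec1 x c : tot2 (const_sec x) c = delta (phi x) c.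
Proof. exact: (tot2_mk (sec1P x)). Qed.
Let tot1_sec2 u c : tot1 (kernel_sec u) c = delta (io u) c.
Proof. exact: (tot1_mk (sec2P u)). Qed.
Let tot2_sec2 u c : tot2 (kernel_sec u) c = 0.
Proof. exact: (tot2_mk (sec2P u)). Qed.

Lemma hom_on_const_sec : hom_on T const_sec.
Proof.
apply: hom_on_tot => c.
  rewrite (_ : (fun u => _) = id) //.
  by apply/funext => x; exact: tot1_sec1.
rewrite (_ : (fun u => _) = fun x => delta (phi x) c); first exact: delta_hom.
by apply/funext => x; exact: tot2_sec1.
Qed.

Lemma hom_on_kernel_sec : hom_on T kernel_sec.
Proof.
apply: hom_on_tot => c.
  rewrite (_ : (fun u => _) = fun x => delta (io x) c); first exact: delta_hom.
  by apply/funext => x; exact: tot1_sec2.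
rewrite (_ : (fun u => _) = fun=> 0); first exact: hom_on_zero.
by apply/funext => x; exact: tot2_sec2.
Qed.

Variables (GY : {group gT}) (Y : kGmod k GY) (sHY : H \subset GY).
Variables (f : Y -> total) (f_hom : hom_on H f).

Let sgvalVK (c : Zs) : (subg Z (sgval c)^-1)^-1%g = c.
Proof. by apply: val_inj; rewrite /= subgK ?groupV ?subgP // invgK. Qed.

Lemma tot1_hom y (c : Zs) : tot1 (f y) c = tot1 (f (kG_act (sgval c)^-1 y)) one.
Proof.
have cZ := subgP c; have [_ fH] := f_hom.
by rewrite fH ?groupV ?ZH // tot1_actZ ?groupV // mulg1 sgvalVK.
Qed.

Lemma tot2_hom y (c : Zs) : tot2 (f y) c = tot2 (f (kG_act (sgval c)^-1 y)) one.
Proof.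
have cZ := subgP c; have [_ fH] := f_hom.
by rewrite fH ?groupV ?ZH // tot2_actZ ?groupV // mulg1 sgvalVK.
Qed.

(** At c, only the translate by c of the second component of const_sec is
    nonzero. *)
Lemma tot2_tr_const_sec (lft : Y -> F) : hom_on T lft ->
  (forall y, phi (lft y) = tot2 (f y) one) ->
  forall y c, tot2 (rel_trace T H (const_sec \o lft) y) c = tot2 (f y) c.
Proof.
move=> atT atE y c.
rewrite tr_dprod //; last exact: hom_on_comp hom_on_const_sec atT.
rewrite (lin_sum (tot2_linear c)) (bigD1 c) //= big1 ?addr0 => [|d ndc].
  by rewrite /conj_map tot2_act_sgval mulVg tot2_sec1 /delta eqxx atE -tot2_hom.
rewrite /conj_map tot2_act_sgval tot2_sec1 /delta ifN //.
by apply: contra ndc => /eqP/(canRL (mulKg _)); rewrite invgK mulg1 => ->.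
Qed.

Lemma tr_kernel_sec (ka : Y -> K) : hom_on T ka -> (forall y, tot2 (f y) one = 0) ->
  (forall y, io (ka y) = tot1 (f y) one) -> f =1 rel_trace T H (kernel_sec \o ka).
Proof.
move=> kaT f0 kaE y.
rewrite tr_dprod //; last exact: hom_on_comp hom_on_kernel_sec kaT.
apply: tot_eq => c.
  rewrite (lin_sum (tot1_linear c)) (bigD1 c) //= big1 ?addr0 => [|d ndc].
    by rewrite /conj_map tot1_act_sgval mulVg tot1_sec2 /delta eqxx kaE -tot1_hom.
  rewrite /conj_map tot1_act_sgval tot1_sec2 /delta ifN //.
  by apply: contra ndc => /eqP/(canRL (mulKg _)); rewrite invgK mulg1 => ->.
rewrite (lin_sum (tot2_linear c)) big1 => [|d _]; first by rewrite tot2_hom f0.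
by rewrite /conj_map tot2_act_sgval tot2_sec2.
Qed.

End Sections.

(** If the identity of the total object is a trace from T up to j, then phi has
    a section up to j. The vector u x has component x at all elements of Z, so
    it is fixed by Z, and the sum of its N-components vanishes in k. The trace
    of th at u x sums the N-components of th (u x), and this sum is the image
    under phi of an F-component. *)
Lemma total_split (th j : total -> total) : #|Z|%:R = 0 :> k -> hom_on T th ->
  (forall x, x = rel_trace T H th x + j x) ->
  exists2 u : N -> total, hom_on T u &
    forall x, x = phi (tot1 (th (u x)) one) + tot2 (j (u x)) one.
Proof.
move=> Z0 thT idE; have [phil _] := phiT.
pose u (x : N) : total := mk_tot (fun=> 0) (fun=> x).
have uP x (c : Zs) : phi ((fun=> 0) c) = \sum_(d : Zs) (fun=> x) d.
  rewrite (lin0 phil) sumr_const -cardsT -scaler_nat; rewrite (_ : #|[set: Zs]| = #|Z|) ?Z0 ?scale0r //.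
  by rewrite -(card_injm (injm_sgval Z) (subsetT _)) im_sgval.
have u1 x c : tot1 (u x) c = 0 by exact: (tot1_mk (uP x)).
have u2 x c : tot2 (u x) c = x by exact: (tot2_mk (uP x)).
have uT : hom_on T u.
  apply: hom_on_tot => c.
    rewrite (_ : (fun x => _) = fun=> 0); first exact: hom_on_zero.
    by apply/funext => x; exact: u1.
  by rewrite (_ : (fun x => _) = id) //; apply/funext => x; rewrite u2.
exists u => // x; rewrite totP.
have {1}-> : x = tot2 (u x) one by rewrite u2.
rewrite [in LHS](idE (u x)) tr_dprod // -[LHS]/(tot2 _ one + _).
congr (_ + _); rewrite (lin_sum (tot2_linear one)).
rewrite [RHS](reindex_inj invg_inj) /=; apply: eq_bigr => d _.
rewrite /conj_map tot2_act_sgval mulg1; congr (tot2 (th _) _).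
apply: tot_eq => c.
  by rewrite tot1_actZ ?groupV ?subgP // !u1.
by rewrite tot2_actZ ?groupV ?subgP // !u2.
Qed.

End AcyclicTotal.

(** * Relative projectives and maps to tensor products *)

Section RelativeProjectives.
Import GRing.Theory.
Local Open Scope ring_scope.
Variables (k : fieldType) (gT : finGroupType).

Definition kG_triv (G : {group gT}) : kGmod k G.
Proof. by exists (k^o : lmodType k) (fun _ a => a). Defined.

Section Associativity.
Variables (G : {group gT}) (U V Y : kGmod k G).

Let UV := kG_tensor U V.
Let VY := kG_tensor V Y.

Let assoc1 (y : Y) : UV -> kG_tensor U VY :=
  tensor_lift (fun u v => @tens _ _ _ U VY u (tens v y)).

Let assoc1_bl y v : linear (fun u : U => @tens _ _ _ U VY u (tens v y)).
Proof. exact: tens_linear_l. Qed.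

Let assoc1_br y u : linear (fun v : V => @tens _ _ _ U VY u (tens v y)).
Proof.
exact: linear_comp (@tens_linear_r _ _ _ U VY u) (@tens_linear_l _ _ _ V Y y).
Qed.

Let assoc1_linear y : linear (assoc1 y).
Proof. exact: tensor_lift_linear (assoc1_bl y) (assoc1_br y). Qed.

Let assoc1E y u v : assoc1 y (tens u v) = @tens _ _ _ U VY u (tens v y).
Proof. exact: tensor_liftE (assoc1_bl y) (assoc1_br y) u v. Qed.

Let assoc1_linear_r t : linear (assoc1^~ t).
Proof.
move=> a y y'; move: t.
apply: (tensor_eq (f := assoc1 (a *: y + y'))
                  (h := fun t => a *: assoc1 y t + assoc1 y' t)) => // [|u v].
  move=> b t t'; rewrite !assoc1_linear !scalerDr !scalerA mulrC.
  by rewrite addrACA.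
rewrite !assoc1E (@tens_linear_r _ _ _ V Y v).
by rewrite (@tens_linear_r _ _ _ U VY u).
Qed.

Definition tassoc : kG_tensor UV Y -> kG_tensor U VY :=
  tensor_lift (fun t y => assoc1 y t).

Lemma tassocE u v y : tassoc (@tens _ _ _ UV Y (tens u v) y) = @tens _ _ _ U VY u (tens v y).
Proof. by rewrite /tassoc tensor_liftE. Qed.

Lemma tassoc_linear : linear tassoc.
Proof. exact: tensor_lift_linear. Qed.

Let coassoc1 (u : U) : VY -> kG_tensor UV Y :=
  tensor_lift (fun v y => @tens _ _ _ UV Y (tens u v) y).

Let coassoc1_bl u y : linear (fun v : V => @tens _ _ _ UV Y (tens u v) y).
Proof.
exact: linear_comp (@tens_linear_l _ _ _ UV Y y) (@tens_linear_r _ _ _ U V u).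
Qed.

Let coassoc1_br u v : linear (fun y : Y => @tens _ _ _ UV Y (tens u v) y).
Proof. exact: tens_linear_r. Qed.

Let coassoc1_linear u : linear (coassoc1 u).
Proof. exact: tensor_lift_linear (coassoc1_bl u) (coassoc1_br u). Qed.

Let coassoc1E u v y : coassoc1 u (tens v y) = @tens _ _ _ UV Y (tens u v) y.
Proof. exact: tensor_liftE (coassoc1_bl u) (coassoc1_br u) v y. Qed.

Let coassoc1_linear_l t : linear (coassoc1^~ t).
Proof.
move=> a u u'; move: t.
apply: (tensor_eq (f := coassoc1 (a *: u + u'))
                  (h := fun t => a *: coassoc1 u t + coassoc1 u' t)) => // [|v y].
  move=> b t t'; rewrite !coassoc1_linear !scalerDr !scalerA mulrC.
  by rewrite addrACA.
rewrite !coassoc1E (@tens_linear_l _ _ _ U V v).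
by rewrite (@tens_linear_l _ _ _ UV Y y).
Qed.

Definition tcoassoc : kG_tensor U VY -> kG_tensor UV Y :=
  tensor_lift (fun u t => coassoc1 u t).

Lemma tcoassocE u v y : tcoassoc (@tens _ _ _ U VY u (tens v y)) = @tens _ _ _ UV Y (tens u v) y.
Proof. by rewrite /tcoassoc tensor_liftE. Qed.

Lemma tcoassoc_linear : linear tcoassoc.
Proof. exact: tensor_lift_linear. Qed.

Lemma tensor3_eq (M : lmodType k) (f h : kG_tensor UV Y -> M) :
  linear f -> linear h ->
  (forall u v y, f (@tens _ _ _ UV Y (tens u v) y) = h (@tens _ _ _ UV Y (tens u v) y)) ->
  f =1 h.
Proof.
move=> fl hl e; apply: tensor_eq => // t y; move: t.
have tl := @tens_linear_l _ _ _ UV Y y.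
apply: (tensor_eq (f := f \o (fun t : UV => @tens _ _ _ UV Y t y))
                  (h := h \o (fun t : UV => @tens _ _ _ UV Y t y))) => [||u v].
- exact: linear_comp fl tl.
- exact: linear_comp hl tl.
exact: e.
Qed.

Lemma tassocK : cancel tassoc tcoassoc.
Proof.
apply: (tensor3_eq (f := tcoassoc \o tassoc) (h := id)) => //.
  exact: linear_comp tcoassoc_linear tassoc_linear.
by move=> u v y; rewrite /= tassocE tcoassocE.
Qed.

Lemma hom_on_tassoc : hom_on G tassoc.
Proof.
split=> [|g gG]; first exact: tassoc_linear.
have al1 := @kG_act_linear _ _ _ (kG_tensor UV Y) _ gG.
have al2 := @kG_act_linear _ _ _ (kG_tensor U VY) _ gG.
apply: (tensor3_eq (f := tassoc \o (kG_act g : kG_tensor UV Y -> kG_tensor UV Y))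
  (h := (kG_act g : kG_tensor U VY -> kG_tensor U VY) \o tassoc)).
- exact: linear_comp tassoc_linear al1.
- exact: linear_comp al2 tassoc_linear.
move=> u v y.
rewrite -[LHS]/(tassoc (kG_act g (@tens _ _ _ UV Y (tens u v) y : kG_tensor UV Y))).
rewrite -[RHS]/(kG_act g (tassoc (@tens _ _ _ UV Y (tens u v) y))).
by rewrite tassocE !act_tens // tassocE.
Qed.

Lemma hom_on_tcoassoc : hom_on G tcoassoc.
Proof.
have K : cancel tcoassoc tassoc.
  move=> t; rewrite -{2}[t]/(id t); move: t.
  apply: (tensor_eq (f := tassoc \o tcoassoc) (h := id)) => // [|u t].
    exact: linear_comp tassoc_linear tcoassoc_linear.
  move: t; apply: (tensor_eq (f := (tassoc \o tcoassoc) \o (fun t : VY => @tens _ _ _ U VY u t))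
    (h := fun t : VY => @tens _ _ _ U VY u t)) => [||v y].
  - apply: linear_comp; first exact: linear_comp tassoc_linear tcoassoc_linear.
    exact: (@tens_linear_r _ _ _ U VY u).
  - exact: (@tens_linear_r _ _ _ U VY u).
  by rewrite /= tcoassocE tassocE.
apply: (hom_on_inj (can_inj tassocK) hom_on_tassoc); first exact: tcoassoc_linear.
by split=> [a u v|g gG u] /=; rewrite !K.
Qed.

End Associativity.

Section Retract.
Variables (G : {group gT}) (w : kGmod k G) (w_findim : kG_findim w).

(** The retracts of the modules w (x) V are closed under tensor products, direct
    sums and summands. *)
Lemma w_projective_retract (X : kGmod k G) : w_projective w X ->
  exists (V : kGmod k G) (i : X -> kG_tensor w V) (r : kG_tensor w V -> X),
    [/\ hom_on G i, hom_on G r & cancel i r].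
Proof.
have [n [/findim_frame[e [c [cl eW]]]]] := w_findim.
elim=> {X} [|X Y _ [V [i [r [iG rG iK]]]]|I X _ IH|X Y XY _ [V [i [r [iG rG iK]]]]].
- exists (kG_triv G), (fun u => tens u (1 : kG_triv G)).
  pose b (u : w) (a : kG_triv G) : w := (a : k) *: u.
  have bl y : linear (b^~ y) by move=> a u v; rewrite /b scalerDr !scalerA mulrC.
  have br x : linear (b x) by move=> a u v; rewrite /b scalerDl scalerA.
  exists (tensor_lift b); split.
  + split=> [a u v|g gG u]; last by rewrite act_tens.
    exact: (@tens_linear_l _ _ _ w (kG_triv G) 1).
  + split=> [|g gG]; first exact: tensor_lift_linear.
    have al := @kG_act_linear _ _ _ (kG_tensor w (kG_triv G)) _ gG.
    have tl := tensor_lift_linear bl br.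
    apply: tensor_eq (linear_comp tl al) (linear_comp (kG_act_linear gG) tl) _.
    move=> x y.
    rewrite -[LHS]/(tensor_lift b (kG_act g (tens x y : kG_tensor w (kG_triv G)))).
    rewrite act_tens // -[RHS]/(kG_act g (tensor_lift b (tens x y))).
    by rewrite !tensor_liftE // /b (linZ (kG_act_linear gG)).
  by move=> u; rewrite tensor_liftE // /b scale1r.
- exists (kG_tensor V Y).
  exists (@tassoc _ w V Y \o tmap i (id : Y -> Y)).
  exists (tmap r (id : Y -> Y) \o @tcoassoc _ w V Y); split.
  + by apply: hom_on_comp (hom_on_tassoc _ _ _) _; apply: hom_on_tmap.
  + by apply: hom_on_comp _ (hom_on_tcoassoc _ _ _); apply: hom_on_tmap.
  move=> x; rewrite /= tassocK; move: x.
  have [[il _] [rl _]] := (iG, rG).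
  by move=> x; rewrite -[LHS]/((_ \o _) x) tmap_comp //; apply: tmap_id.
- pose V j := projT1 (cid (IH j)).
  pose i j := projT1 (cid (projT2 (cid (IH j)))).
  pose r j := projT1 (cid (projT2 (cid (projT2 (cid (IH j)))))).
  have ir j : [/\ hom_on G (i j), hom_on G (r j) & cancel (i j) (r j)].
    exact: projT2 (cid (projT2 (cid (projT2 (cid (IH j)))))).
  have il j : linear (i j) by have [[]] := ir j.
  have rl j : linear (r j) by have [_ []] := ir j.
  exists (kG_dsum V), (@codistr _ _ _ w I V n e c cl \o dsum_map il).
  exists (dsum_map rl \o @distr _ _ _ w I V); split.
  + apply: hom_on_comp; first exact: hom_on_codistr.
    by apply: hom_on_dsum_map => // j; have [] := ir j.
  + apply: hom_on_comp; last exact: hom_on_distr.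
    by apply: hom_on_dsum_map => // j; have [] := ir j.
  move=> x; rewrite /= (codistrK cl eW).
  apply: dsum_eq => j; have [_ _ K] := ir j; exact: K.
have [i0 [r0 [i0G r0G i0K]]] := direct_summand_retract XY.
exists V, (i \o i0), (r0 \o r); split; [exact: hom_on_comp|exact: hom_on_comp|].
by move=> x; rewrite /= iK i0K.
Qed.

End Retract.

Section LiftsOfTensors.
Variables (T : {group gT}) (W : kGmod k T).
Variables (n : nat) (e : 'I_n -> W) (c : 'I_n -> W -> k).
Hypotheses (cl : forall j, linear (c j : W -> k^o))
  (eW : forall u, u = \sum_j c j u *: e j).

(** W (x) S is the set of the elements of W (x) V with all coordinates in S. *)
Lemma lift_tensor_sub (V : kGmod k T) (S : {pred V}) (S_sub : submod_closed S)
    (S_act : forall g x, g \in T -> x \in S -> kG_act g x \in S)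
    (GY : {group gT}) (Y : kGmod k GY) (f : Y -> kG_tensor W V) :
  hom_on T f -> (forall y j, tcoord c j (f y) \in S) ->
  exists2 f' : Y -> kG_tensor W (kG_sub S_sub S_act), hom_on T f' &
    forall y, tmap (id : W -> W) (@sub_incl _ _ _ _ _ S_sub S_act) (f' y) = f y.
Proof.
move=> fT fS; set io := @sub_incl _ _ _ _ _ _ _.
have ioT : hom_on T io := hom_on_sub_incl S_sub S_act; have [iol _] := ioT.
pose f' y : kG_tensor W (kG_sub S_sub S_act) :=
  \sum_j tens (e j) (sub_lift S_sub S_act (tcoord c j (f y))).
have tl := tmap_linear (X := W) (X' := W) (f := id) (fun _ _ _ => erefl) iol.
have f'E y : tmap (id : W -> W) io (f' y) = f y.
  rewrite (lin_sum tl) [RHS](tcoord_sum cl eW); apply: eq_bigr => j _.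
  by rewrite tmapE // [io _]sub_liftK.
have t_inj : injective (tmap (id : W -> W) io).
  move=> t t' ett'; rewrite (tcoord_sum cl eW t) (tcoord_sum cl eW t').
  apply: eq_bigr => j _; suff -> : tcoord c j t = tcoord c j t' by [].
  apply: (@sub_incl_inj _ _ _ _ _ S_sub S_act); rewrite -/io.
  by rewrite -!(tcoord_tmap (c := c) (c' := c) (f := id)) // ett'.
exists f' => //; apply: (hom_on_inj t_inj).
- by apply: hom_on_tmap.
- by move=> a u v; apply: t_inj; rewrite tl !f'E; have [->] := fT.
by rewrite (_ : _ \o f' = f) //; apply/funext.
Qed.

Section Cover.
Variable M : kGmod k T.

Let gens (s : seq M) (x : M) := exists2 t, t \in T & exists2 m, m \in s & x = kG_act t m.

Definition fg_sub (s : seq M) : {pred M} := lspan (gens s).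

Lemma fg_sub_closed s : submod_closed (fg_sub s).
Proof. exact: lspan_submod. Qed.

Lemma fg_sub_act s g x : g \in T -> x \in fg_sub s -> kG_act g x \in fg_sub s.
Proof.
move=> gT'; move: x; have gl := @kG_act_linear _ _ _ M _ gT'.
apply: (lspan_min (P := fun x => kG_act g x \in fg_sub s)).
- by rewrite (lin0 gl) rpred0.
- by move=> a u v Pu Pv; rewrite gl; apply: rpredD => //; apply: rpredZ.
move=> _ [t tT [m ms ->]]; apply: mem_lspan; exists (g * t)%g; first exact: groupM.
by exists m; rewrite // kG_actM.
Qed.

Definition fg_mod s : kGmod k T := kG_sub (@fg_sub_closed s) (@fg_sub_act s).

Lemma findim_fg_mod s : kG_findim (fg_mod s).
Proof.
apply: finspan_axiom.
pose lft := sub_lift (@fg_sub_closed s) (@fg_sub_act s).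
pose io := @sub_incl _ _ _ _ _ (@fg_sub_closed s) (@fg_sub_act s).
have [iol _] := hom_on_sub_incl (@fg_sub_closed s) (@fg_sub_act s).
have io_inj := @sub_incl_inj _ _ _ _ _ (@fg_sub_closed s) (@fg_sub_act s).
exists [seq lft (kG_act t m) | t <- enum T, m <- s] => x.
suff [y yS yx] : exists2 y : fg_mod s, y \in lspan (fun z => z \in
    [seq lft (kG_act t m) | t <- enum T, m <- s]) & io y = io x.
  by rewrite -(io_inj _ _ yx).
have := sub_inclP x; rewrite -/io; move: (io x).
apply: lspan_min.
- by exists 0; rewrite ?rpred0 // (lin0 iol).
- move=> a _ _ [u uS <-] [v vS <-]; exists (a *: u + v); last exact: iol.
  by apply: rpredD => //; apply: rpredZ.
move=> _ [t tT [m ms ->]]; exists (lft (kG_act t m)).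
  by apply: mem_lspan; apply: allpairs_f => //; rewrite mem_enum.
by apply: sub_liftK; apply: mem_lspan; exists t => //; exists m.
Qed.

Definition cover : kGmod k T := kG_dsum fg_mod.

Let incl s : fg_mod s -> M := @sub_incl _ _ _ _ _ (@fg_sub_closed s) (@fg_sub_act s).

Let inclT s : hom_on T (@incl s).
Proof. exact: hom_on_sub_incl. Qed.

Definition cover_map : cover -> M := dsum_lift incl.

Lemma hom_on_cover_map : hom_on T cover_map.
Proof. by apply: hom_on_dsum_lift => // s; have [] := inclT s. Qed.

(** A finite dimensional module maps to W (x) M through W (x) M' with M'
    finitely generated, so the cover stays pure after tensoring with W. *)
Lemma cover_lift (GY : {group gT}) (Y : kGmod k GY) (a : Y -> kG_tensor W M) :
  kG_findim Y -> hom_on T a ->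
  exists2 a' : Y -> kG_tensor W cover, hom_on T a' &
    forall y, tmap (id : W -> W) cover_map (a' y) = a y.
Proof.
move=> [m [/findim_finspan[sY sYE]]] aT; have [al _] := aT.
pose s := [seq tcoord c j (a y) | j <- enum 'I_n, y <- sY].
have aS y j : tcoord c j (a y) \in fg_sub s.
  have tl := linear_comp (@tcoord_linear _ _ _ W M n c cl j) al.
  apply: (lspan_min (P := fun y => tcoord c j (a y) \in fg_sub s)) (sYE y).
  - by rewrite -[tcoord c j _]/((tcoord c j \o a) 0) (lin0 tl) rpred0.
  - move=> b u v Pu Pv; rewrite -[tcoord c j _]/((tcoord c j \o a) _) tl.
    by apply: rpredD => //; apply: rpredZ.
  move=> {}y ys; apply: mem_lspan; exists 1%g => //.
  exists (tcoord c j (a y)); last by rewrite kG_act1.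
  by apply: allpairs_f => //; rewrite mem_enum.
have [a1 a1T a1E] := lift_tensor_sub (@fg_sub_closed s) (@fg_sub_act s) aT aS.
have inT := @hom_on_dsum_in _ _ _ _ fg_mod s.
exists (tmap (id : W -> W) (@dsum_in _ _ _ _ fg_mod s) \o a1).
  by apply: hom_on_comp a1T; apply: hom_on_tmap.
move=> y; rewrite -a1E -[LHS]/((_ \o _) (a1 y)) tmap_comp //.
- congr (tmap _ _ _); apply/funext => x /=.
  by rewrite /cover_map dsum_lift_in // => s'; have [] := inclT s'.
- by have [] := hom_on_cover_map.
by have [] := inT.
Qed.

Lemma pp_cover : pp_map T (id : kG_tensor W cover -> kG_tensor W cover).
Proof.
exists (seq M), (fun s => kG_tensor W (fg_mod s)).
exists (@distr _ _ _ W _ fg_mod), (@codistr _ _ _ W _ fg_mod n e c cl); split.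
- move=> s; apply: findim_tensor (findim_fg_mod s).
  apply: finspan_axiom; exists [seq e j | j <- enum 'I_n] => v.
  rewrite [v]eW; apply: rpred_sum => j _; apply/rpredZ/mem_lspan.
  by apply: map_f; rewrite mem_enum.
- exact: hom_on_distr.
- exact: hom_on_codistr.
by apply/funext => x /=; rewrite (distrK cl eW).
Qed.

End Cover.
End LiftsOfTensors.

(** By the projection formula, a trace of a map through Res W (x) V factors
    through W (x) Ind V. *)
Lemma tr_factor (B T : {group gT}) (sBT : B \subset T) (W : kGmod k T)
    (GY GZ : {group gT}) (Y : kGmod k GY) (Z : kGmod k GZ) (V : kGmod k B)
    (a : Y -> kG_tensor (kG_res sBT W) V) (b : kG_tensor (kG_res sBT W) V -> Z) :
  T \subset GY -> T \subset GZ -> hom_on B a -> hom_on B b ->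
  exists (U : kGmod k T) (a' : Y -> kG_tensor W U) (b' : kG_tensor W U -> Z),
    [/\ hom_on T a', hom_on T b' & rel_trace B T (b \o a) = b' \o a'].
Proof.
move=> sTY sTZ aB bB.
have ind := induced_by_tensor sBT W (induced_by_ind sBT V).
pose U := kG_ind T V.
pose ext := @tmap k gT B T (kG_res sBT W) V W U id (@ind_ext _ _ B T V).
pose ev := @tmap k gT T B W U (kG_res sBT W) V id (@ind_ev _ _ B T V).
have [xB eB _] : induced_by B T ext ev := ind.
exists U, (rel_trace B T (ext \o a)), (rel_trace B T (b \o ev)); split.
- by apply: hom_on_tr => //; apply: hom_on_comp.
- by apply: hom_on_tr => //; apply: hom_on_comp.
have [bl _] := bB.
apply/funext => x.
exact: (tr_induced a sBT (subxx T) sTZ (subxx B) ind bl x).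
Qed.

End RelativeProjectives.

(** * A phantom module that is not w-projective *)

Section Generation.
Import GRing.Theory.
Local Open Scope ring_scope.
Variables (k : fieldType) (gT : finGroupType).

Lemma sensitive_max (G : {group gT}) (w : kGmod k G) (T0 : {group gT}) :
  sensitive w T0 -> exists2 T : {group gT}, sensitive w T &
    forall H : {group gT}, T \proper H -> ~ sensitive w H.
Proof.
have [n] := ubnP (#|gT| - #|T0|); elim: n T0 => // n IH T0 ltn sT0.
have [[H pTH sH]|noH] := pselect (exists2 H : {group gT}, T0 \proper H & sensitive w H).
  apply: (IH H) => //; apply: leq_trans (_ : #|gT| - #|T0| <= n)%N; last by [].
  by apply: ltn_sub2l; [apply: leq_trans (proper_card pTH) (max_card _)|apply: proper_card].
by exists T0 => // H pTH sH; apply: noH; exists H.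
Qed.

(** A subgroup B of T x Z that is not T meets T properly, up to conjugacy, so
    the traces from B only contribute traces from proper subgroups of T. *)
Lemma negligible_res_dprod (H T Z : {group gT}) (X Y : kGmod k H) (f : X -> Y) :
  (T \x Z = H)%g -> prime #|Z| -> negligible H f ->
  exists th j, [/\ hom_on T th, negligible T j & f = rel_trace T H th \+ j].
Proof.
move=> defH Zp; have [nsTH _] := dprod_normal2 defH.
have sTH := normal_sub nsTH; have cardH := dprod_card defH.
have JT0 : negligible T (fun _ : X => 0 : Y) by apply/negligible_pp/pp_map0.
elim=> {f} [f ppf|B th pBH thB|f h _ [thf [jf [thfT jfT ->]]] _ [thh [jh [thhT jhT ->]]]].
- exists (fun=> 0), f; split; first exact: hom_on_zero.
    exact/negligible_pp/(pp_map_res sTH).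
  apply/funext => x /=; rewrite /rel_trace big1 ?add0r // => A /repr_lcosets[] // rH _.
  exact: (lin0 (kG_act_linear rH)).
- have sBH := proper_sub pBH.
  have [eBT|neBT] := eqVneq B T.
    exists th, (fun=> 0); split; [by rewrite -eBT|by []|].
    by rewrite eBT; apply/funext => x /=; rewrite addr0.
  exists (fun=> 0), (rel_trace B H th); split; first exact: hom_on_zero; last first.
    apply/funext => x /=; rewrite {2}/rel_trace big1 ?add0r // => A /repr_lcosets[] // rH _.
    exact: (lin0 (kG_act_linear rH)).
  apply: (mackey sTH sBH (subxx H) (subxx H) thB) => //.
    by move=> f h; apply: negligible_add.
  move=> g gH; set D := (T :&: B :^ g^-1)%G.
  have sDT : D \subset T by apply: subsetIl.
  apply: (@negligible_tr _ _ _ _ _ _ _ D); last first.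
    by apply: hom_on_sub (subsetIr _ _) _; apply: hom_on_conj_map.
  rewrite properE sDT /=; apply: contra neBT => sTD.
  have sTB : T \subset (B :^ g^-1)%g := subset_trans sTD (subsetIr _ _).
  have [m cardB] : exists m, #|B| = (m * #|T|)%N.
    by apply/dvdnP; rewrite -(cardJg B g^-1); apply: cardSg sTB.
  have : (m %| #|Z|)%N.
    have := cardSg sBH; rewrite cardB -cardH mulnC dvdn_pmul2l ?cardG_gt0 //.
  case/primeP: (Zp) => _ min_Z /min_Z/pred2P[m1|mZ]; last first.
    by have := proper_card pBH; rewrite cardB mZ -cardH mulnC ltnn.
  have defT : (T :=: B :^ g^-1)%g.
    by apply/eqP; rewrite eqEcard sTB cardJg cardB m1 mul1n leqnn.
  apply/eqP/val_inj => /=; have nTg := fintype.subsetP (normal_norm nsTH) _ gH.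
  by rewrite -(normP nTg) defT -conjsgM mulVg conjsg1.
exists (thf \+ thh), (jf \+ jh); split.
- exact: hom_on_add.
- exact: negligible_add.
by apply/funext => x; rewrite /= tr_add //= addrACA.
Qed.

Lemma w_factors_comp (G : {group gT}) (w P X Y : kGmod k G) (f : kG_hom X Y)
    (a : X -> P) (b : P -> Y) :
  w_projective w P -> hom_on G a -> hom_on G b -> (f : X -> Y) = b \o a ->
  w_factors w f.
Proof.
move=> wP aG bG fE; exists P, (mk_kG_hom aG), (mk_kG_hom bG); split=> //.
exact: val_inj.
Qed.

Lemma w_factors_tr (G H : {group gT}) (sHG : H \subset G) (w X Y : kGmod k G)
    (V : kGmod k H) (f : kG_hom X Y) (a : X -> kG_tensor (kG_res sHG w) V)
    (b : kG_tensor (kG_res sHG w) V -> Y) :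
  hom_on H a -> hom_on H b -> (f : X -> Y) = rel_trace H G (b \o a) -> w_factors w f.
Proof.
move=> aH bH fE.
have [U [a' [b' [a'G b'G e]]]] := tr_factor (subxx G) (subxx G) aH bH.
apply: (w_factors_comp _ a'G b'G); last by rewrite fE.
exact/w_proj_tensor/w_proj_self.
Qed.

Section Key.
Variables (G : {group gT}) (w : kGmod k G) (w_findim : kG_findim w).
Variables (H T Z : {group gT}) (sHG : H \subset G) (defH : (T \x Z = H)%g).
Hypotheses (Z_prime : prime #|Z|) (Z_char : #|Z|%:R = 0 :> k).

Let sTH : T \subset H. Proof. by have [/normal_sub] := dprod_normal2 defH. Qed.
Let wH := kG_res sHG w.
Let W := kG_res sTH wH.

Variable M : kGmod k T.

Let F := kG_tensor W (cover M).
Let N := kG_tensor W M.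
Let cm := @cover_map _ _ _ M.
Let phi : F -> N := tmap (id : W -> W) cm.

Let cmT : hom_on T cm. Proof. exact: hom_on_cover_map. Qed.

Lemma phiT : hom_on T phi. Proof. exact: hom_on_tmap. Qed.

Let X := total defH phiT.

(** Lift the N-component of f through the cover, and subtract the trace of the
    lift composed with const_sec. The difference has its F-component in the
    kernel of phi, which is w (x) ker cm, and is the trace of this component. *)
Lemma phantom_total (GY : {group gT}) (Y : kGmod k GY) (f : Y -> X) :
  H \subset GY -> kG_findim Y -> hom_on H f ->
  exists (V1 V2 : kGmod k H) (a1 : Y -> kG_tensor wH V1)
      (b1 : kG_tensor wH V1 -> X) (a2 : Y -> kG_tensor wH V2)
      (b2 : kG_tensor wH V2 -> X),
    [/\ hom_on H a1 /\ hom_on H b1, hom_on H a2 /\ hom_on H b2 &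
        f = (b1 \o a1) \+ (b2 \o a2)].
Proof.
move=> sHY fdY fH; have fT := hom_on_sub sTH fH.
have fdW : kG_findim W := w_findim.
have [n [/findim_frame[e [c [cl eW]]]]] := fdW.
pose one : subg_of Z := 1%g.
have aT : hom_on T (fun y => tot2 (f y) one).
  exact: hom_on_comp (hom_on_tot2 defH phiT one) fT.
have [lft atT atE] := cover_lift cl eW fdY aT.
have s1T := hom_on_const_sec defH phiT.
pose f2 := f \- rel_trace T H (const_sec defH phiT \o lft).
have tH : hom_on H (rel_trace T H (const_sec defH phiT \o lft)).
  by apply: hom_on_tr => //; apply: hom_on_comp.
have f2H : hom_on H f2 by apply: hom_on_diff.
have f20 y d : tot2 (f2 y) d = 0.
  rewrite /f2 (linB (tot2_linear d)) (tot2_tr_const_sec sHY fH atT) ?subrr //.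
have kaT : hom_on T (fun y => tot1 (f2 y) one).
  exact: hom_on_comp (hom_on_tot1 defH phiT one) (hom_on_sub sTH f2H).
pose S : {pred cover M} := fun x => cm x == 0.
have [cml cmE] := cmT.
have S_sub : submod_closed S.
  split; first by rewrite unfold_in (lin0 cml).
  by move=> a u v /eqP u0 /eqP v0; rewrite unfold_in cml u0 v0 scaler0 addr0.
have S_act g y : g \in T -> y \in S -> kG_act g y \in S.
  by move=> gT' /eqP y0; rewrite unfold_in cmE // y0 (lin0 (kG_act_linear gT')).
have kaS y j : tcoord c j (tot1 (f2 y) one : F) \in S.
  rewrite unfold_in -(tcoord_tmap (c := c) (c' := c) (f := id) (X' := W)) //.
  rewrite -[tmap _ _ _]/(phi _) totP big1 => [|d _]; last exact: f20.
  by rewrite (lin0 (tcoord_linear _ _)).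
have [ka kaT' kaE] := lift_tensor_sub cl eW S_sub S_act kaT kaS.
pose io : kG_tensor W (kG_sub S_sub S_act) -> F :=
  tmap (id : W -> W) (@sub_incl _ _ _ _ _ S_sub S_act).
have ioT : hom_on T io by apply: hom_on_tmap => //; apply: hom_on_sub_incl.
have phi_io u : phi (io u) = 0.
  have [[iol _] [phil _]] := (ioT, phiT); move: u.
  have inl := proj1 (hom_on_sub_incl S_sub S_act).
  apply: (tensor_eq (f := phi \o io) (h := fun=> 0)) => [||x y].
  - exact: linear_comp.
  - exact: linear_zero.
  rewrite /= /io tmapE // /phi tmapE //.
  have /eqP -> : cm (sub_incl y) == 0 := sub_inclP y.
  exact: (lin0 (@tens_linear_r _ _ _ W M x)).
have s2T := hom_on_kernel_sec defH phiT ioT phi_io.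
have f2E := tr_kernel_sec ioT phi_io sHY f2H kaT' (fun y => f20 y one) kaE.
have [V1 [a1 [b1 [a1H b1H e1]]]] := tr_factor (W := wH) sHY (subxx H) atT s1T.
have [V2 [a2 [b2 [a2H b2H e2]]]] := tr_factor (W := wH) sHY (subxx H) kaT' s2T.
exists V1, V2, a1, b1, a2, b2; split=> //.
by rewrite -e1 -e2 -(funext f2E); apply/funext => y; rewrite /f2 /= addrC subrK.
Qed.

Let Xh := kG_ind G X.
Let ext : X -> Xh := @ind_ext _ _ H G X.
Let ev : Xh -> X := @ind_ev _ _ H G X.

Let extH : hom_on H ext. Proof. by case: (induced_by_ind sHG X). Qed.
Let evH : hom_on H ev. Proof. by case: (induced_by_ind sHG X). Qed.

(** The identity of the induced module is a trace from H, so f is the trace of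
    the map to the total object that corresponds to it. *)
Lemma phantom_ind (Y : kGmod k G) (f : kG_hom Y Xh) :
  kG_findim Y -> w_factors w f.
Proof.
move=> fdY; have fG : hom_on G f := kG_homP f.
have fH : hom_on H (ev \o f) by apply: hom_on_comp (hom_on_sub sHG fG).
have [V1 [V2 [a1 [b1 [a2 [b2 [[a1H b1H] [a2H b2H] e]]]]]]] :=
  phantom_total sHG fdY fH.
have b1H' : hom_on H (ext \o b1) by apply: hom_on_comp.
have b2H' : hom_on H (ext \o b2) by apply: hom_on_comp.
have t1G : is_kG_hom (rel_trace H G ((ext \o b1) \o a1)).
  by apply: hom_on_tr => //; apply: hom_on_comp.
have t2G : is_kG_hom (rel_trace H G ((ext \o b2) \o a2)).
  by apply: hom_on_tr => //; apply: hom_on_comp.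
have -> : f = 1 *: mk_kG_hom t1G + mk_kG_hom t2G.
  apply/val_inj/funext => y.
  rewrite -[RHS]/(1 *: rel_trace H G ((ext \o b1) \o a1) y + rel_trace H G ((ext \o b2) \o a2) y).
  rewrite scale1r -[RHS]/((_ \+ _) y) -tr_add //.
  rewrite -[LHS](tr_ind sHG) -[LHS]/((rel_trace H G (ext \o ev) \o f) y).
  rewrite -tr_compr //; congr (rel_trace H G _ y); apply/funext => z /=.
  rewrite -[ev (f z)]/((ev \o f) z) e /=.
  by have [xl _] := extH; rewrite (linD xl).
have F1 : w_factors w (mk_kG_hom t1G) by apply: w_factors_tr a1H b1H' _.
have F2 : w_factors w (mk_kG_hom t2G) by apply: w_factors_tr a2H b2H' _.
exact: w_factorsP F1 F2.
Qed.

(** If the induced module is w-projective, the total object is a retract of some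
    w (x) V over H, so that its identity is negligible over H. Over T, that is
    the hypothesis of total_split with j negligible. *)
Lemma negligible_id_total : ~ sensitive w H -> w_factors w (kG_id Xh) ->
  negligible T (id : N -> N).
Proof.
move=> nsH [P [a [b [wP abE]]]].
have [V [i [r [iG rG iK]]]] := w_projective_retract w_findim wP.
have [aG bG] : hom_on G a /\ hom_on G b := conj (kG_homP a) (kG_homP b).
pose VH := kG_res sHG V.
pose s : kG_tensor w V -> kG_tensor wH VH := @tmap k gT G H w V wH VH id id.
pose s' : kG_tensor wH VH -> kG_tensor w V := @tmap k gT H G wH VH w V id id.
have sH : hom_on H s by apply: hom_on_tmap.
have s'H : hom_on H s' by apply: hom_on_tmap.
have sK x : s' (s x) = x.
  by rewrite -[LHS]/((s' \o s) x) /s /s' tmap_comp //; apply: tmap_id.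
have JV : negligible H (id : kG_tensor wH VH -> kG_tensor wH VH).
  by apply: contrapT => nJ; apply: nsH; exists sHG, VH.
have iH := hom_on_sub sHG iG; have rH := hom_on_sub sHG rG.
have aH := hom_on_sub sHG aG; have bH := hom_on_sub sHG bG.
pose f1 : X -> kG_tensor wH VH := s \o (i \o (a \o ext)).
pose f2 : kG_tensor wH VH -> X := ev \o (b \o (r \o s')).
have f1H : hom_on H f1 by do 3!apply: hom_on_comp => //.
have f2H : hom_on H f2 by do 3!apply: hom_on_comp => //.
have JX : negligible H (id : X -> X).
  have -> : (id : X -> X) = f2 \o id \o f1.
    apply/funext => x; rewrite /f1 /f2 /= sK iK.
    have abK y : b (a y) = y by rewrite -[RHS]/(kG_id Xh y) abE.
    rewrite abK; have [_ _ evE] := induced_by_ind sHG X.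
    have := evE 1%g x (group1 G); rewrite group1 !kG_act1.
    by rewrite -/ext -/ev => ->.
  by apply: negligible_compr f1H _; apply: negligible_compl f2H _.
have [th [j [thT jJ idE]]] := negligible_res_dprod defH Z_prime JX.
have [u uT uE] := total_split (th := th) (j := j) Z_char thT
  (fun x => congr1 (@^~ x) idE).
pose one : subg_of Z := 1%g.
have t1T := hom_on_tot1 defH phiT one; have t2T := hom_on_tot2 defH phiT one.
pose q1 (x : X) : F := tot1 x one; pose q2 (x : X) : N := tot2 x one.
have -> : (id : N -> N) = (phi \o (id \o (q1 \o (th \o u)))) \+ (q2 \o (j \o u)).
  by apply/funext => x /=; rewrite -uE.
have fdW : kG_findim W := w_findim.
have [n [/findim_frame[e [c [cl eW]]]]] := fdW.
have JF : negligible T (id : F -> F) := negligible_pp (pp_cover cl eW M).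
have thuT : hom_on T (th \o u) := hom_on_comp thT uT.
have q1T : hom_on T (q1 \o (th \o u)) := hom_on_comp t1T thuT.
have J1 : negligible T (phi \o (id \o (q1 \o (th \o u)))).
  exact: negligible_compl phiT (negligible_compr q1T JF).
have J2 : negligible T (q2 \o (j \o u)) := negligible_compl t2T (negligible_compr uT jJ).
exact: negligible_add J1 J2.
Qed.

Lemma not_generates : ~ sensitive w H -> ~ negligible T (id : N -> N) ->
  ~ generates_StMod w (@stmod k gT G).
Proof.
move=> nsH nJ gen; apply: nJ; apply: negligible_id_total => //.
have [|f [h [hf _]]] := gen Xh.
  move=> Y fdY f.
  have -> : f = st_class w (st_repr f) by rewrite /st_class /st_repr reprK.
  rewrite -(lin0 (@lquot_pi_linear _ _ (@w_factors _ _ _ w Y Xh))).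
  by apply/st_class_eq; rewrite subr0; apply: phantom_ind.
have /st_class_eq[P [a [b [wP e]]]] : st_class w (kG_comp (st_repr h) (st_repr f)) = st_class w (kG_id Xh).
  exact: hf.
have bN : is_kG_hom ((fun x => - b x) : P -> Xh).
  have [bl bG] := kG_homP b; split=> [c u v|g gG x].
    by rewrite bl opprD scalerN.
  by rewrite bG // (linN (kG_act_linear gG)).
exists P, a, (mk_kG_hom bN); split=> //; apply/val_inj/funext => x.
have := congr1 (fun q : kG_hom Xh Xh => q x) e.
rewrite -[X in X = _ -> _]/(st_repr h (st_repr f x) - x).
rewrite (_ : st_repr f x = 0); last by apply/rowP => -[].
have [hl _] := kG_homP (st_repr h); rewrite (lin0 hl) sub0r => e'.
by rewrite -[LHS]/x -[LHS]opprK e'.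
Qed.

End Key.
End Generation.

(** Cq centralises P' and meets it trivially, so a conjugate of an element of
    order p of Cq does the same for T. *)
Lemma central_complement (gT : finGroupType) (G T P' Cq P : {group gT})
    (p : nat) (y : gT) :
  prime p -> p %| #|Cq| -> (P' \x Cq = P)%g -> P \subset G -> T \subset G ->
  y \in G -> (T :^ y)%g \subset P' ->
  exists Z H : {group gT}, [/\ #|Z| = p, (T \x Z = H)%g & H \subset G].
Proof.
move=> p_pr pC defP sPG sTG yG sTP'.
have [z0 z0C oz0] := Cauchy p_pr pC.
have [_ defPC cPC tiPC] := dprodP defP.
have z0G : z0 \in G.
  by apply: (fintype.subsetP sPG); rewrite -defPC -[z0]mul1g mem_mulg.
pose Z := <[z0 ^ y^-1]>%G.
have ZE : (Z :=: <[z0]> :^ y^-1)%g by rewrite /= cycleJ.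
have sz0C : (<[z0]> \subset Cq)%g by rewrite cycle_subG.
have cTZ : Z \subset ('C(T))%g.
  rewrite ZE -(conjSg _ _ y) -conjsgM mulVg conjsg1 -centJ.
  by apply: subset_trans sz0C _; apply: subset_trans cPC _; apply: centS.
have tiTZ : (T :&: Z = 1)%g.
  rewrite ZE; apply/trivgP; rewrite -(conjSg _ _ y) conjIg -conjsgM mulVg conjsg1 conjs1g.
  by rewrite -tiPC; apply: setISS.
exists Z, (T <*> Z)%G; split; last 2 first.
- exact: dprodEY.
- by rewrite join_subG sTG cycle_subG groupJ ?groupV.
by rewrite ZE cardJg.
Qed.

Theorem theorem3p5 (k : fieldType) (p : nat) (p_char : p \in [pchar k]%R)
    (gT : finGroupType) (G : {group gT}) (p_dvd_G : p %| #|G|)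
    (w : kGmod k G) (w_findim : kG_findim w)
    (Q : {group gT}) (Q_vertex : is_vertex Q w)
    (P : {group gT}) (sylP : (p.-Sylow(G) P)%g)
    (P' Cq : {group gT}) (q : nat) (defP : (P' \x Cq = P)%g)
    (Cq_cyclic : cyclic Cq) (card_Cq : #|Cq| = q)
    (q_gt1 : 1 < q) (q_pow : exists n : nat, q = p ^ n)
    (Q_sub : exists2 x, x \in G & (Q :^ x)%g \subset P')
    (sP'G : P' \subset G)
    (P'_wild : exists M : kGmod k P',
       ~ pure_projective M /\
       ~ pure_projective (kG_tensor M (kG_res sP'G w))) :
  ~ generates_StMod w (@stmod k gT G).
Proof.
have p_pr : prime p by have [] := andP p_char.
have p_C : p %| #|Cq|.
  by rewrite card_Cq; case: q_pow q_gt1 => -[|n] ->; rewrite ?expnS ?dvdn_mulr.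
have [sQG projQ _] := Q_vertex.
have [M [_ nppM]] := P'_wild.
have [T0 sT0] : exists T, sensitive w T.
  apply: contrapT => noS; apply/nppM/pp_pure_projective/insensitive_pp => B sB.
  by apply: noS; exists B.
have [T sT maxT] := sensitive_max sT0.
have [g gG sTQ] := sensitive_sub sQG projQ sT.
have [x xG sQP'] := Q_sub.
have [sTG [M1 nJ]] := sT.
have sTP' : (T :^ (g^-1 * x))%g \subset P'.
  rewrite conjsgM; apply: subset_trans sQP'; rewrite conjSg.
  by rewrite -(conjSg _ _ g) -conjsgM mulVg conjsg1.
have [|Z [H [oZ defH sHG]]] :=
  central_complement p_pr p_C defP (pHall_sub sylP) sTG _ sTP'.
  by rewrite groupM ?groupV.
have pTH : T \proper H.
  have [/normal_sub sTH _] := dprod_normal2 defH.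
  rewrite properEcard sTH -(dprod_card defH) oZ.
  by rewrite -[X in X < _]muln1 ltn_pmul2l ?cardG_gt0 ?prime_gt1.
have sTH := proper_sub pTH.
apply: (@not_generates _ _ G w w_findim H T Z sHG defH _ _ M1).
- by rewrite oZ.
- by rewrite oZ; apply/eqP; case/andP: p_char.
- exact: maxT.
have resE (s1 : T \subset H) : kG_res s1 (kG_res sHG w) = kG_res sTG w.
  rewrite /kG_res; f_equal; exact: Prop_irrelevance.
by rewrite resE.
Qed.
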